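(* Let $1\to K\to G\to Q\to 1$ be an $\mathrm{abf}$-exact sequence of finitely generated groups. Suppose $Q$ is torsion-free abelian and $\mathcal{W}_1(G)$ is finite. Then $\dim_{\mathbb{Q}}B_{\mathbb{Q}}(K)\otimes\mathbb{Q}<\infty$ and $\theta_n(K)=0$ for all sufficiently large $n$.
   Context: $G_{\mathrm{abf}}=G_{\mathrm{ab}}/\mathrm{Tors}(G_{\mathrm{ab}})$. A short exact sequence of groups $1\to K\to G\to Q\to 1$ is $\mathrm{abf}$-exact if the induced sequence $0\to K_{\mathrm{abf}}\to G_{\mathrm{abf}}\to Q_{\mathrm{abf}}\to 0$ is exact. For $G$ finitely generated, $\mathcal{W}_1(G)$ is the set of $\rho$ in the identity component $\mathbb{T}^0_G=\mathrm{Hom}(G_{\mathrm{abf}},\mathbb{C}^* )$ of $\mathrm{Hom}(G,\mathbb{C}^* )$ with $\dim_{\mathbb{C}}H_1(G,\mathbb{C}_\rho)\ge1$, where $\mathbb{C}_\rho$ is $\mathbb{C}$ with $G$-action via $\rho$. For $S\subseteq K$, $\sqrt{S}=\{g\in K: g^m\in S\text{ for some }m>0\}$; $K'_{\mathbb{Q}}=\sqrt{[K,K]}$, $K''_{\mathbb{Q}}=\sqrt{[K'_{\mathbb{Q}},K'_{\mathbb{Q}}]}$; the rational Alexander invariant is $B_{\mathbb{Q}}(K)=K'_{\mathbb{Q}}/K''_{\mathbb{Q}}$ (an abelian group). With $K'=[K,K]$, $K''=[K',K']$, the Chen ranks are $\theta_n(K)=\dim_{\mathbb{Q}}\mathrm{gr}_n(K/K'')\otimes\mathbb{Q}$,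 where $\mathrm{gr}_n(H)=\gamma_n(H)/\gamma_{n+1}(H)$, $\gamma_1(H)=H$, $\gamma_{n+1}(H)=[H,\gamma_n(H)]$. *)

(* Defs.v *)
From HB Require Import structures.
From mathcomp Require Import all_boot all_order all_algebra.
From mathcomp Require Import boolp classical_sets functions cardinality.
From mathcomp Require Import reals constructive_ereal.
From mathcomp Require Import complex.
From mathcomp Require Import freeg.

Set Implicit Arguments.
Unset Strict Implicit.
Unset Printing Implicit Defensive.

Import Order.TTheory GRing.Theory Num.Theory.

Local Open Scope classical_set_scope.
Local Open Scope quotient_scope.
Local Open Scope group_scope.

Definition is_subgroup (G : groupType) (S : set G) : Prop :=
  [/\ S 1, forall x y, S x -> S y -> S (x * y) & forall x, S x -> S x^-1].

Definition generated_by (G : groupType) (A : set G) : set G :=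
  smallest (@is_subgroup G) A.

Definition finitely_generated (G : groupType) : Prop :=
  exists A : set G, finite_set A /\ generated_by A = setT.

Definition abelian_group (G : groupType) : Prop := forall x y : G, x * y = y * x.

Definition torsion_free (G : groupType) : Prop :=
  forall (x : G) (m : nat), (0 < m)%N -> x ^+ m = 1 -> x = 1.

Record normal_subgroup (G : groupType) := NormalSubgroup {
  nsub_set :> G -> Prop;
  nsub_subgroup : is_subgroup nsub_set;
  nsubJ : forall x y, nsub_set x -> nsub_set (x ^ y)
}.

Section NormalSubgroupTheory.
Variables (G : groupType) (N : normal_subgroup G).

Lemma nsub1 : N 1. Proof. by case: (nsub_subgroup N). Qed.

Lemma nsubM x y : N x -> N y -> N (x * y).
Proof. by case: (nsub_subgroup N) => _ + _; apply. Qed.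

Lemma nsubV x : N x -> N x^-1.
Proof. by case: (nsub_subgroup N) => _ _; apply. Qed.

Lemma nsubX x m : N x -> N (x ^+ m).
Proof.
by move=> Nx; elim: m => [|m IHm]; rewrite ?expgS; [exact: nsub1|exact: nsubM].
Qed.

Lemma nsub_rot x y : N (x * y) -> N (y * x).
Proof.
by move=> /(@nsubJ _ _ _ x); rewrite conjgE !mulgA mulVg mul1g.
Qed.

End NormalSubgroupTheory.

Section QuotientGroup.
Variables (G : groupType) (N : normal_subgroup G).

Definition cosetr : rel G := fun x y => `[< N (x^-1 * y) >].

Lemma cosetr_refl : reflexive cosetr.
Proof. by move=> x; apply/asboolP; rewrite mulVg; exact: nsub1. Qed.

Lemma cosetr_sym : symmetric cosetr.
Proof.
move=> x y; apply/asboolP/asboolP => /nsubV; by rewrite invgM invgK.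
Qed.

Lemma cosetr_trans : transitive cosetr.
Proof.
move=> y x z /asboolP Nxy /asboolP Nyz; apply/asboolP.
by have := nsubM Nxy Nyz; rewrite mulgA mulgK.
Qed.

Canonical cosetr_equiv := EquivRel cosetr cosetr_refl cosetr_sym cosetr_trans.

Definition quotg : Type := {eq_quot cosetr}.
HB.instance Definition _ := Choice.on quotg.
HB.instance Definition _ := EqQuotient.on quotg.

Definition quot_proj (x : G) : quotg := \pi_quotg x.

Lemma quot_projP x y : quot_proj x = quot_proj y <-> N (x^-1 * y).
Proof.
split=> [/eqmodP /asboolP //|Nxy]; apply/eqmodP; exact/asboolP.
Qed.

Lemma quot_reprK (a : quotg) : quot_proj (repr a) = a.
Proof. exact: reprK. Qed.

Definition quot_mul (a b : quotg) := quot_proj (repr a * repr b).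
Definition quot_inv (a : quotg) := quot_proj (repr a)^-1.

Lemma quot_mulE x y : quot_mul (quot_proj x) (quot_proj y) = quot_proj (x * y).
Proof.
apply/quot_projP.
have /quot_projP Nx := quot_reprK (quot_proj x).
have /quot_projP Ny := quot_reprK (quot_proj y).
set x' := repr _ in Nx *; set y' := repr _ in Ny *.
rewrite invgM.
have -> : y'^-1 * x'^-1 * (x * y) = (x'^-1 * x) ^ y' * (y'^-1 * y).
  by rewrite conjgE !mulgA mulgK.
by apply: nsubM => //; exact: nsubJ.
Qed.

Lemma quot_invE x : quot_inv (quot_proj x) = quot_proj x^-1.
Proof.
apply/quot_projP; rewrite invgK; apply: nsub_rot.
by apply/quot_projP; rewrite quot_reprK.
Qed.

Lemma quot_ind (P : quotg -> Prop) : (forall x, P (quot_proj x)) -> forall a, P a.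
Proof. by move=> Px a; rewrite -[a]quot_reprK. Qed.

Lemma quot_mulA : associative quot_mul.
Proof.
elim/quot_ind=> x; elim/quot_ind=> y; elim/quot_ind=> z.
by rewrite !quot_mulE mulgA.
Qed.

Lemma quot_mul1 : left_id (quot_proj 1) quot_mul.
Proof. by elim/quot_ind=> x; rewrite quot_mulE mul1g. Qed.

Lemma quot_mulr1 : right_id (quot_proj 1) quot_mul.
Proof. by elim/quot_ind=> x; rewrite quot_mulE mulg1. Qed.

Lemma quot_mulV : left_inverse (quot_proj 1) quot_inv quot_mul.
Proof. by elim/quot_ind=> x; rewrite quot_invE quot_mulE mulVg. Qed.

Lemma quot_mulrV : right_inverse (quot_proj 1) quot_inv quot_mul.
Proof. by elim/quot_ind=> x; rewrite quot_invE quot_mulE mulgV. Qed.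

HB.instance Definition _ :=
  isGroup.Build quotg quot_mulA quot_mul1 quot_mulr1 quot_mulV quot_mulrV.

Lemma quot_projM : {morph quot_proj : x y / x * y}.
Proof. by move=> x y; rewrite -quot_mulE. Qed.

Lemma quot_projF : {morph quot_proj : x y / x / y}.
Proof. by move=> x y; rewrite quot_projM; congr (_ * _); rewrite -quot_invE. Qed.

HB.instance Definition _ := isGroupMorphism.Build G quotg quot_proj quot_projF.

Lemma quot_proj_eq1 x : quot_proj x = 1 <-> N x.
Proof.
split=> [/esym/quot_projP|Nx]; first by rewrite invg1 mul1g.
by apply/esym/quot_projP; rewrite invg1 mul1g.
Qed.

End QuotientGroup.

Section SubgroupType.
Variables (G : groupType) (H : normal_subgroup G).

Definition subg_pred : {pred G} := fun x => x \in (nsub_set H : set G).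

Definition subgT : Type := {x : G | subg_pred x}.
HB.instance Definition _ := SubChoice.on subgT.

Lemma subg_closed : group_closed subg_pred.
Proof.
split; first by apply/mem_set; exact: nsub1.
move=> x y /set_mem Hx /set_mem Hy; apply/mem_set.
by apply: nsubM => //; exact: nsubV.
Qed.

HB.instance Definition _ := SubChoice_isSubGroup.Build G subg_pred subgT subg_closed.

Lemma subg_restrict_subgroup (N : normal_subgroup G) :
  is_subgroup [set x : subgT | N (val x)].
Proof.
split=> [|x y|x]; rewrite /mkset; first by rewrite val1; exact: nsub1.
  by rewrite valM; exact: nsubM.
by move=> /nsubV; rewrite gmulfV.
Qed.

Lemma subg_restrictJ (N : normal_subgroup G) (x y : subgT) :
  N (val x) -> N (val (x ^ y)).
Proof. by move=> Nx; rewrite gmulfJ; exact: nsubJ. Qed.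

Definition subg_restrict (N : normal_subgroup G) : normal_subgroup subgT :=
  NormalSubgroup (subg_restrict_subgroup N) (@subg_restrictJ N).

End SubgroupType.

(* The group H / N, for N contained in H. *)
Definition subquot (G : groupType) (H N : normal_subgroup G) : groupType :=
  quotg (subg_restrict H N).

Definition whole_group (G : groupType) : normal_subgroup G.
Proof. by exists (fun=> True). Defined.

Section Commutators.
Variable G : groupType.
Implicit Types H N : normal_subgroup G.

Lemma generated_subgroup (A : set G) : is_subgroup (generated_by A).
Proof.
split=> [S [[S1 _ _] _] //|x y Ax Ay S SA|x Ax S SA].
  by have [[_ SM _] _] := SA; apply: SM; [exact: Ax|exact: Ay].
by have [[_ _ SV] _] := SA; apply: SV; exact: Ax.
Qed.

Lemma sub_generated (A : set G) : A `<=` generated_by A.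
Proof. by move=> x Ax S [_]; apply. Qed.

Lemma generatedJ (A : set G) :
  (forall x y, A x -> A (x ^ y)) ->
  forall x y, generated_by A x -> generated_by A (x ^ y).
Proof.
move=> AJ x y /(_ [set z | generated_by A (z ^ y)]); apply; split.
  have [g1 gM gV] := generated_subgroup A.
  split=> /= [|u v|u]; rewrite ?conj1g ?conjMg ?conjVg //; [exact: gM|exact: gV].
by move=> z Az /=; apply: sub_generated; exact: AJ.
Qed.

Definition commutator_set H N : set G :=
  [set z | exists x y, [/\ H x, N y & z = [~ x, y]]].

Lemma commutator_setJ H N x y : commutator_set H N x -> commutator_set H N (x ^ y).
Proof.
move=> [u [v [Hu Nv ->]]]; exists (u ^ y), (v ^ y).
by split; [exact: nsubJ|exact: nsubJ|exact: conjRg].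
Qed.

Definition commutator_subgroup H N : normal_subgroup G :=
  NormalSubgroup (generated_subgroup (commutator_set H N))
                 (generatedJ (@commutator_setJ H N)).

Lemma commutator_commg H N x y : H x -> N y -> commutator_subgroup H N [~ x, y].
Proof. by move=> Hx Ny; apply: sub_generated; exists x, y. Qed.

End Commutators.

Definition derived_subgroup (G : groupType) (H : normal_subgroup G) :=
  commutator_subgroup H H.

Section RationalDerived.
Variable G : groupType.

Definition root_set (S : set G) : set G :=
  [set g | exists2 m : nat, (0 < m)%N & S (g ^+ m)].

Lemma root_set_idem (S : set G) : root_set (root_set S) `<=` root_set S.
Proof.
move=> x [m m0 [n n0 Sx]]; exists (m * n)%N; first by rewrite muln_gt0 m0.
by rewrite expgnA.
Qed.

Variable H : normal_subgroup G.
Hypothesis rootH : root_set H `<=` H.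
Let D := derived_subgroup H.

Lemma derived_expgMn x y m :
  H x -> H y -> quot_proj D ((x * y) ^+ m) = quot_proj D (x ^+ m * y ^+ m).
Proof.
move=> Hx Hy; have cxy : commute (quot_proj D x) (quot_proj D y).
  apply/commgP/eqP; have -> : [~ quot_proj D x, quot_proj D y]
      = quot_proj D [~ x, y] by rewrite gmulfR.
  by apply/quot_proj_eq1; exact: commutator_commg.
by rewrite gmulfXn !gmulfM expgMn// !gmulfXn.
Qed.

Lemma root_derived_subgroup : is_subgroup (root_set D).
Proof.
have DH x : D x -> H x.
  move=> /(_ H); apply; split; first exact: nsub_subgroup.
  move=> _ [u [v [Hu Hv ->]]]; rewrite commgEl; apply: nsubM; first exact: nsubV.
  exact: nsubJ.
have rDH x : root_set D x -> H x.
  by move=> [m m0 Dx]; apply: rootH; exists m => //; exact: DH.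
split=> [|x y Dx Dy|x [m m0 Dx]]; first by exists 1%N => //; exact: nsub1.
- have [Hx Hy] := (rDH _ Dx, rDH _ Dy).
  move: Dx Dy => [m m0 Dx] [n n0 Dy].
  exists (m * n)%N; first by rewrite muln_gt0 m0.
  apply/quot_proj_eq1; rewrite derived_expgMn//; apply/quot_proj_eq1.
  apply: nsubM; first by rewrite expgnA; exact: nsubX.
  by rewrite mulnC expgnA; exact: nsubX.
- by exists m => //; rewrite expVgn; exact: nsubV.
Qed.

Lemma root_derivedJ x y : root_set D x -> root_set D (x ^ y).
Proof. by move=> [m m0 Dx]; exists m => //; rewrite -conjXg; exact: nsubJ. Qed.

Definition root_derived : normal_subgroup G :=
  NormalSubgroup root_derived_subgroup root_derivedJ.

End RationalDerived.

Definition ab (G : groupType) : groupType :=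
  quotg (derived_subgroup (whole_group G)).

Lemma ab_abelian (G : groupType) : abelian_group (ab G).
Proof.
elim/quot_ind=> x; elim/quot_ind=> y.
rewrite -!quot_projM; apply/quot_projP.
have -> : (x * y)^-1 * (y * x) = [~ y, x]. by rewrite invgM commgEl conjgE !mulgA.
exact: commutator_commg.
Qed.

Section Torsion.
Variables (A : groupType) (abA : abelian_group A).

Definition torsion_set : set A := [set a | exists2 m : nat, (0 < m)%N & a ^+ m = 1].

Lemma torsion_subgroup : is_subgroup torsion_set.
Proof.
split=> [|x y [m m0 xm] [n n0 yn]|x [m m0 xm]]; first by exists 1%N.
  exists (m * n)%N; first by rewrite muln_gt0 m0.
  rewrite expgMn; last exact: abA.
  by rewrite expgnA xm mulnC expgnA yn !expg1n mul1g.
by exists m => //; rewrite expVgn xm invg1.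
Qed.

Lemma torsionJ x y : torsion_set x -> torsion_set (x ^ y).
Proof. by rewrite conjgE (abA x) mulgA mulVg mul1g. Qed.

Definition Tors : normal_subgroup A := NormalSubgroup torsion_subgroup torsionJ.

End Torsion.

Definition abf (G : groupType) : groupType := quotg (Tors (@ab_abelian G)).

Definition abf_proj (G : groupType) (x : G) : abf G := quot_proj _ (quot_proj _ x).

Section QuotMap.
Variables (G H : groupType) (N : normal_subgroup G) (M : normal_subgroup H).
Variable f : G -> H.

Definition quot_map (a : quotg N) : quotg M := quot_proj M (f (repr a)).

Lemma quot_mapE : {morph f : x y / x * y} -> (forall x, N x -> M (f x)) ->
  forall x, quot_map (quot_proj N x) = quot_proj M (f x).
Proof.
move=> fM fNM x; apply/quot_projP.
have f1 : f 1 = 1 by apply: (mulgI (f 1)); rewrite -fM !mulg1.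
have fV y : f y^-1 = (f y)^-1.
  by apply/esym/mulg1_eq; rewrite -fM mulgV.
rewrite -fV -fM; apply: fNM.
by apply/quot_projP; rewrite quot_reprK.
Qed.

End QuotMap.
Arguments quot_map {G H N M} f a.

Definition abf_map (G H : groupType) (f : G -> H) : abf G -> abf H :=
  quot_map (quot_map f).

Lemma abf_mapE (G H : groupType) (f : {multiplicative G -> H}) (x : G) :
  abf_map f (abf_proj x) = abf_proj (f x).
Proof.
have f1 : f 1 = 1 by apply: (mulgI (f 1)); rewrite -gmulfM !mulg1.
have fV y : f y^-1 = (f y)^-1 by apply/esym/mulg1_eq; rewrite -gmulfM mulgV.
pose DG := derived_subgroup (whole_group G).
pose DH := derived_subgroup (whole_group H).
pose fab : ab G -> ab H := quot_map f.
have DGH y : DG y -> DH (f y).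
  have [D1 DM DV] := nsub_subgroup DH.
  move=> /(_ [set z | DH (f z)]); apply; split.
    split=> /= [|u v|u]; rewrite ?f1 ?gmulfM ?fV //; [exact: DM|exact: DV].
  move=> _ [u [v [_ _ ->]]] /=; rewrite !gmulfM !fV -conjgE -commgEl.
  exact: commutator_commg.
have fabE y : fab (quot_proj _ y) = quot_proj _ (f y).
  by apply: quot_mapE => //; exact: gmulfM.
have fabM : {morph fab : a b / a * b}.
  elim/quot_ind=> a; elim/quot_ind=> b.
  by rewrite -quot_projM !fabE gmulfM quot_projM.
have fab1 : fab 1 = 1 by apply: (mulgI (fab 1)); rewrite -fabM !mulg1.
rewrite /abf_map /abf_proj -/fab quot_mapE ?fabE // => a [m m0 am].
exists m => //; suff <- : fab (a ^+ m) = fab a ^+ m by rewrite am.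
by elim: (m) => [|k IHk]; rewrite ?fab1 // !expgS fabM IHk.
Qed.

Definition short_exact (K G Q : groupType) (i : K -> G) (p : G -> Q) : Prop :=
  [/\ injective i, range i = [set g | p g = 1] & range p = setT].

Definition abf_exact (K G Q : groupType) (i : K -> G) (p : G -> Q) : Prop :=
  short_exact (abf_map i) (abf_map p).

Local Open Scope ring_scope.

Section Submodules.
Variables (F : fieldType) (V : lmodType F).

Definition is_submodule (S : set V) : Prop :=
  S 0 /\ forall a u v, S u -> S v -> S (a *: u + v).

Record submodule := Submodule {
  submod_set :> V -> Prop;
  submodP : is_submodule submod_set
}.

Definition linear_span_set (A : set V) : set V := smallest is_submodule A.

Lemma linear_span_submodule (A : set V) : is_submodule (linear_span_set A).
Proof.
split=> [S [[S0 _] _] //|a u v Au Av S SA].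
by have [[_ SD] _] := SA; apply: SD; [exact: Au|exact: Av].
Qed.

Definition linear_span (A : set V) : submodule := Submodule (linear_span_submodule A).

Section Theory.
Variable W : submodule.

Lemma submod0 : W 0. Proof. by case: (submodP W). Qed.

Lemma submodD u v : W u -> W v -> W (u + v).
Proof. by case: (submodP W) => _ WD Wu Wv; rewrite -[u]scale1r; exact: WD. Qed.

Lemma submodZ a u : W u -> W (a *: u).
Proof.
by case: (submodP W) => W0 WD Wu; rewrite -[_ *: _]addr0; exact: WD.
Qed.

Lemma submodN u : W u -> W (- u).
Proof. by rewrite -scaleN1r; exact: submodZ. Qed.

Lemma submodB u v : W u -> W v -> W (u - v).
Proof. by move=> Wu Wv; apply: submodD => //; exact: submodN. Qed.

End Theory.
End Submodules.

Section QuotientModule.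
Variables (F : fieldType) (V : lmodType F) (W : submodule V).

Definition congr_mod : rel V := fun u v => `[< W (u - v) >].

Lemma congr_mod_refl : reflexive congr_mod.
Proof. by move=> u; apply/asboolP; rewrite subrr; exact: submod0. Qed.

Lemma congr_mod_sym : symmetric congr_mod.
Proof. by move=> u v; apply/asboolP/asboolP => /submodN; rewrite opprB. Qed.

Lemma congr_mod_trans : transitive congr_mod.
Proof.
move=> v u w /asboolP Wuv /asboolP Wvw; apply/asboolP.
by have := submodD Wuv Wvw; rewrite addrA subrK.
Qed.

Canonical congr_mod_equiv :=
  EquivRel congr_mod congr_mod_refl congr_mod_sym congr_mod_trans.

Definition quotV : Type := {eq_quot congr_mod}.
HB.instance Definition _ := Choice.on quotV.
HB.instance Definition _ := EqQuotient.on quotV.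

Definition quotV_proj (u : V) : quotV := \pi_quotV u.

Lemma quotV_projP u v : quotV_proj u = quotV_proj v <-> W (u - v).
Proof.
split=> [/eqmodP /asboolP //|Wuv]; apply/eqmodP; exact/asboolP.
Qed.

Lemma quotV_reprK (a : quotV) : quotV_proj (repr a) = a.
Proof. exact: reprK. Qed.

Lemma quotV_repr_sub u : W (repr (quotV_proj u) - u).
Proof. by apply/quotV_projP; rewrite quotV_reprK. Qed.

Lemma quotV_ind (P : quotV -> Prop) :
  (forall u, P (quotV_proj u)) -> forall a, P a.
Proof. by move=> Pu a; rewrite -[a]quotV_reprK. Qed.

Definition quotV_add (a b : quotV) := quotV_proj (repr a + repr b).
Definition quotV_opp (a : quotV) := quotV_proj (- repr a).
Definition quotV_scale (c : F) (a : quotV) := quotV_proj (c *: repr a).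

Lemma quotV_addE u v :
  quotV_add (quotV_proj u) (quotV_proj v) = quotV_proj (u + v).
Proof.
apply/quotV_projP; rewrite opprD addrACA.
by apply: submodD; exact: quotV_repr_sub.
Qed.

Lemma quotV_oppE u : quotV_opp (quotV_proj u) = quotV_proj (- u).
Proof. by apply/quotV_projP; rewrite -opprD; exact/submodN/quotV_repr_sub. Qed.

Lemma quotV_scaleE c u : quotV_scale c (quotV_proj u) = quotV_proj (c *: u).
Proof. by apply/quotV_projP; rewrite -scalerBr; exact/submodZ/quotV_repr_sub. Qed.

Lemma quotV_addA : associative quotV_add.
Proof.
elim/quotV_ind=> u; elim/quotV_ind=> v; elim/quotV_ind=> w.
by rewrite !quotV_addE addrA.
Qed.

Lemma quotV_addC : commutative quotV_add.
Proof.
by elim/quotV_ind=> u; elim/quotV_ind=> v; rewrite !quotV_addE addrC.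
Qed.

Lemma quotV_add0 : left_id (quotV_proj 0) quotV_add.
Proof. by elim/quotV_ind=> u; rewrite quotV_addE add0r. Qed.

Lemma quotV_addN : left_inverse (quotV_proj 0) quotV_opp quotV_add.
Proof. by elim/quotV_ind=> u; rewrite quotV_oppE quotV_addE addNr. Qed.

HB.instance Definition _ :=
  GRing.isZmodule.Build quotV quotV_addA quotV_addC quotV_add0 quotV_addN.

Lemma quotV_scaleA c d a :
  quotV_scale c (quotV_scale d a) = quotV_scale (c * d) a.
Proof. by elim/quotV_ind: a => u; rewrite !quotV_scaleE scalerA. Qed.

Lemma quotV_scale1 : left_id 1 quotV_scale.
Proof. by elim/quotV_ind=> u; rewrite quotV_scaleE scale1r. Qed.

Lemma quotV_scaleDr : right_distributive quotV_scale +%R.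
Proof.
move=> c; elim/quotV_ind=> u; elim/quotV_ind=> v.
by rewrite [_ + _]quotV_addE !quotV_scaleE [RHS]quotV_addE scalerDr.
Qed.

Lemma quotV_scaleDl a : {morph quotV_scale^~ a : c d / c + d}.
Proof.
move=> c d; elim/quotV_ind: a => u.
by rewrite !quotV_scaleE [RHS]quotV_addE scalerDl.
Qed.

HB.instance Definition _ := GRing.Zmodule_isLmodule.Build F quotV
  quotV_scaleA quotV_scale1 quotV_scaleDr quotV_scaleDl.

Lemma quotV_proj_linear : linear quotV_proj.
Proof. by move=> c u v; rewrite -quotV_addE -quotV_scaleE. Qed.

HB.instance Definition _ :=
  GRing.isLinear.Build F V quotV _ quotV_proj quotV_proj_linear.

End QuotientModule.

Section SubmoduleType.
Variables (F : fieldType) (V : lmodType F) (W : submodule V).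

Definition subm_pred : {pred V} := fun u => u \in (submod_set W : set V).

Definition submT : Type := {u : V | subm_pred u}.
HB.instance Definition _ := SubChoice.on submT.

Lemma subm_closed : subsemimod_closed subm_pred.
Proof.
split; first split; first by apply/mem_set; exact: submod0.
  by move=> u v /set_mem Wu /set_mem Wv; apply/mem_set; exact: submodD.
by move=> a u /set_mem Wu; apply/mem_set; exact: submodZ.
Qed.

HB.instance Definition _ :=
  GRing.SubChoice_isSubLmodule.Build F V subm_pred submT subm_closed.

Lemma subm_restrict_submodule (X : submodule V) :
  is_submodule [set u : submT | X (val u)].
Proof.
split=> [|a u v]; rewrite /mkset ?raddf0; first exact: submod0.
rewrite linearP => Xu Xv; apply: submodD => //; exact: submodZ.
Qed.

Definition subm_restrict (X : submodule V) : submodule submT :=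
  Submodule (subm_restrict_submodule X).

End SubmoduleType.

Section LinearMaps.
Variables (F : fieldType) (U V : lmodType F) (f : {linear U -> V}).

Lemma ker_submodule : is_submodule [set u | f u = 0].
Proof.
split=> [|a u v]; rewrite /mkset ?linear0// linearP => -> ->.
by rewrite scaler0 addr0.
Qed.

Lemma im_submodule : is_submodule (range f).
Proof.
split; first by exists 0 => //; rewrite linear0.
by move=> a _ _ [u _ <-] [v _ <-]; exists (a *: u + v) => //; rewrite linearP.
Qed.

Definition lin_ker : submodule U := Submodule ker_submodule.
Definition lin_im : submodule V := Submodule im_submodule.

End LinearMaps.

Definition is_basis (F : fieldType) (V : lmodType F) (d : nat) (e : 'I_d -> V) :=
  forall v : V, exists! c : {ffun 'I_d -> F}, v = \sum_(j < d) c j *: e j.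

Definition dimension (F : fieldType) (V : lmodType F) : \bar int :=
  if pselect (exists d : nat, exists e : 'I_d -> V, is_basis e) is left fd
  then (projT1 (cid fd))%:Z%:E else +oo%E.

Section FreeModule.
Variables (F : fieldType) (T : choiceType) (M : lmodType F) (f : T -> M).

Lemma freegZU (a c : F) (x : T) : a *: << c *g x >> = << (a * c) *g x >>.
Proof. by apply/eqP/freeg_eqP => y; rewrite coeffZ !coeffU mulrA. Qed.

Lemma fglift_linear : linear (fglift f).
Proof.
have fD : {morph fglift f : D E / D + E}.
  move=> D E; have fB := lift_is_additive f.
  have f0 : fglift f 0 = 0 by rewrite -(subrr 0) fB subrr.
  have fN u : fglift f (- u) = - fglift f u by rewrite -sub0r fB f0 sub0r.
  by rewrite -[E in LHS]opprK fB fN opprK.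
have f0 : fglift f 0 = 0 by apply: (addrI (fglift f 0)); rewrite -fD !addr0.
move=> a D E; rewrite fD; congr (_ + _).
rewrite -[D]freeg_sumE scaler_sumr !(big_morph _ fD f0) scaler_sumr.
by apply: eq_bigr => x _; rewrite freegZU !liftU scalerA.
Qed.

HB.instance Definition _ :=
  GRing.isLinear.Build F {freeg T / F} M _ (fglift f) fglift_linear.

End FreeModule.

(* A (x)_Z Q for an abelian group A written multiplicatively: the Q-vector
   space generated by the symbols [a] subject to [ab] = [a] + [b]. *)
Definition tensQ (A : groupType) : lmodType rat :=
  quotV (linear_span [set r : {freeg A / rat} |
    exists a b : A, r = << (a * b)%g >> - << a >> - << b >>]).

Section Homology.
Variables (C : fieldType) (G : groupType) (rho : G -> C).

(* C_rho (x)_{Z[G]} (bar resolution of Z), in degrees 0, 1, 2, where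
   z (x) g.x is identified with rho(g) z (x) x. The other usual convention,
   rho(g)^-1 z (x) x, amounts to exchanging rho and rho^-1. *)
Definition bar_d1 : {freeg G / C} -> C^o := fglift (fun g => rho g - 1 : C^o).

Definition bar_d2 : {freeg (G * G)%type / C} -> {freeg G / C} :=
  fglift (fun gh => rho gh.1 *: << gh.2 >> - << (gh.1 * gh.2)%g >> + << gh.1 >>).

HB.instance Definition _ :=
  GRing.isLinear.Build C {freeg G / C} C^o _ bar_d1 (fglift_linear _).
HB.instance Definition _ :=
  GRing.isLinear.Build C {freeg (G * G)%type / C} {freeg G / C} _ bar_d2
    (fglift_linear _).

Lemma bar_d1_d2 c : {morph rho : g h / (g * h)%g >-> g * h} ->
  bar_d1 (bar_d2 c) = 0.
Proof.
move=> rhoM; have d1U x : bar_d1 << x >> = rho x - 1.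
  by rewrite /bar_d1 liftU scale1r.
rewrite -[c]freeg_sumE !linear_sum big1 // => -[g h] _ /=.
have -> : bar_d2 << coeff (g, h) c *g (g, h) >> = coeff (g, h) c *:
    (rho g *: << h >> - << (g * h)%g >> + << g >>) by exact: liftU.
rewrite linearZ linearD linearB linearZ /= !d1U rhoM [_ *: _ as X in X - _]mulrBr.
by rewrite mulr1 opprB [X in X + _]addrC subrKA subrKA subrr scaler0.
Qed.

Definition homology1 : lmodType C :=
  quotV (subm_restrict (lin_ker bar_d1) (lin_im bar_d2)).

End Homology.

Section CharacteristicVariety.
Variables (R : realType) (G : groupType).

Definition characters (A : groupType) : set (A -> R[i]) :=
  [set chi | (forall a, chi a != 0) /\
             {morph chi : a b / (a * b)%g >-> a * b}].

(* The identity component Hom(G_abf, C^* ) of Hom(G, C^* ), embedded by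
   precomposition with G -> G_abf. *)
Definition character_torus : set (G -> R[i]) :=
  [set chi \o @abf_proj G | chi in @characters (abf G)].

Definition W1 : set (G -> R[i]) :=
  [set rho | character_torus rho /\ (1 <= dimension (homology1 rho))%E].

End CharacteristicVariety.
Arguments characters R A : clear implicits.
Arguments character_torus R G : clear implicits.
Arguments W1 R G : clear implicits.

Section RationalAlexander.
Variable K : groupType.

Lemma root_whole_group :
  root_set (whole_group K : K -> Prop) `<=` (whole_group K : K -> Prop).
Proof. by []. Qed.

Definition derivedQ : normal_subgroup K := root_derived root_whole_group.

Lemma root_derivedQ : root_set (derivedQ : K -> Prop) `<=` (derivedQ : K -> Prop).
Proof. exact: root_set_idem. Qed.

Definition derivedQ2 : normal_subgroup K := root_derived root_derivedQ.

Definition alexanderQ : groupType := subquot derivedQ derivedQ2.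

End RationalAlexander.

(* lower_central G n is gamma_n(G) for n >= 1; the value at 0 is a dummy. *)
Fixpoint lower_central (G : groupType) (n : nat) : normal_subgroup G :=
  if n is m.+1 then
    if m is 0 then whole_group G
    else commutator_subgroup (whole_group G) (lower_central G m)
  else whole_group G.

Definition gr_lcs (G : groupType) (n : nat) : groupType :=
  subquot (lower_central G n) (lower_central G n.+1).

Definition max_metabelian (K : groupType) : groupType :=
  quotg (derived_subgroup (derived_subgroup (whole_group K))).

Definition chen_rank (K : groupType) (n : nat) : \bar int :=
  dimension (tensQ (gr_lcs (max_metabelian K) n)).

(* Main.v *)
Require Import Defs.
From HB Require Import structures.
From mathcomp Require Import all_boot all_order all_algebra.
From mathcomp Require Import boolp classical_sets functions cardinality.
From mathcomp Require Import reals constructive_ereal.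
From mathcomp Require Import complex freeg.
From mathcomp Require Import zify ring.
From mathcomp Require lebesgue_measure.

Set Implicit Arguments.
Unset Strict Implicit.
Unset Printing Implicit Defensive.

Import Order.TTheory GRing.Theory Num.Theory.

(** Write [K'_Q] for the kernel of [K -> K_abf]. As [Q] is torsion-free abelian,
    [G'_Q] lies in [K], and abf-exactness embeds [K_abf] in [G_abf]; hence
    [K'_Q = G'_Q], and [K] and [G] have the same rational Alexander invariant [B].
    It is acted upon by the abelian group [G_abf], and generated as a module, up
    to roots, by the commutators of generators of [G] ([alexanderQ_generated]).

    Let [phi : B -> C] be a nonzero additive map on which [G] acts through a
    character [rho != 1]. It extends to a crossed homomorphism on [G], which is
    not principal because it is nonzero on [G'_Q], where [rho] is trivial; hence
    [H_1(G, C_rho) != 0] and [rho] lies in [W_1(G)] ([eigen_homology]). So only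
    finitely many characters [rho] occur. By the Nullstellensatz, for each [g] the
    polynomial whose roots are the values [rho g] is nilpotent on [C (x) B]
    ([support_poly_nilpotent]): otherwise the commuting operators of [G] would
    have a common eigenfunctional with another eigenvalue at [g]
    ([common_eigenfunctional], which rests on [C] being uncountable while
    [C (x) B] has countable dimension). Thus each [g] satisfies a monic equation on
    [C (x) B], and finitely many translates of the generators of [B] detect all
    additive maps [B -> C]. The group [C] being divisible, such maps separate the
    points of [B] from root-closed subgroups ([separating_functional]), so [B]
    has finite rank ([finite_support_finite_rank]). This is the first claim.

    The images in [B] of the terms of the lower central series of [K], closed
    under roots, form a decreasing chain, which is stationary because [B] has
    finite rank ([isolated_chain_stationary]). So for [n] large each element of
    [gamma_n(K)] has a power in [gamma_(n+1)(K)], up to an element of [K''_Q]. To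
    absorb the latter one works in the metabelian group [M = K/K'']. Modulo the
    elements of [M'] with a power in [gamma_(n+1)(M)], an element of [M] with a
    power in [M'] acts on [M'] by an automorphism which is unipotent and of finite
    order; the group acted upon being torsion-free, this automorphism is trivial.
    It follows that commutators of such elements have a power in
    [gamma_(n+1)(M)] ([derived_root_comm]). Therefore [gr_n(M)] is a torsion
    group, and the Chen rank vanishes ([chen_rank_vanish]). *)

Local Open Scope classical_set_scope.
Local Open Scope ring_scope.

(** * Functionals on abelian groups *)

(** Zorn's lemma for inclusion, with a starting point, so that chains may be
    assumed nonempty. *)
Lemma Zorn_maximal_set (T : Type) (P : set (set T)) (X0 : set T) :
  X0 !=set0 -> P X0 ->
  (forall F : set (set T), F !=set0 -> F `<=` P -> total_on F subset ->
     P (\bigcup_(X in F) X)) ->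
  exists2 X, P X & forall Y, P Y -> X `<=` Y -> Y `<=` X.
Proof.
move=> [x0 X0x0] PX0 chainP.
have [|X [PX maxX]] := @Zorn_bigcup T [set X | X = set0 \/ P X].
  move=> F FP totF; have [/chainP PF|F0] := pselect ((F `&` P) !=set0).
    right; have -> : \bigcup_(X in F) X = \bigcup_(X in F `&` P) X.
      apply/seteqP; split=> x [X]; last by move=> [FX _] Xx; exists X.
      move=> FX Xx; exists X => //; split=> //.
      by case: (FP _ FX) => // X_eq0; move: Xx; rewrite X_eq0.
    apply: PF; first by move=> X [].
    by move=> X Y [FX _] [FY _]; exact: totF.
  left; apply/seteqP; split=> // x [X FX Xx].
  case: (FP _ FX) => [X_eq0|PX]; first by move: Xx; rewrite X_eq0.
  by apply: F0; exists X.
exists X => [|Y PY XY].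
  case: PX => // X_eq0; have [] := maxX X0; last by right.
  by rewrite X_eq0; split=> // /(_ _ X0x0).
by apply: contrapT => YX; apply: (maxX Y); [split|right].
Qed.

Lemma generated_min (G : groupType) (A S : set G) :
  is_subgroup S -> A `<=` S -> generated_by A `<=` S.
Proof. by move=> subS AS x; apply. Qed.

Section Functionals.
Variables (A : groupType) (F : numFieldType).
Hypothesis abA : abelian_group A.

Definition additive_fun (h : A -> F) := {morph h : x y / (x * y)%g >-> x + y}.

Section Theory.
Variable h : A -> F.
Hypothesis hD : additive_fun h.

Lemma additive_fun1 : h 1%g = 0.
Proof. by apply: (addrI (h 1%g)); rewrite -hD mulg1 addr0. Qed.

Lemma additive_funV x : h x^-1%g = - h x.
Proof. by apply: (addrI (h x)); rewrite -hD mulgV additive_fun1 subrr. Qed.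

Lemma additive_funX x m : h (x ^+ m)%g = m%:R * h x.
Proof.
elim: m => [|m IHm]; first by rewrite expg0 additive_fun1 mul0r.
by rewrite expgS hD IHm mulrSr mulrDl mul1r addrC.
Qed.

Lemma additive_ker_subgroup : is_subgroup [set x | h x = 0].
Proof.
split=> [|x y|x] /=; first exact: additive_fun1.
  by rewrite hD => -> ->; rewrite addr0.
by rewrite additive_funV => ->; rewrite oppr0.
Qed.

Lemma additive_ker_root x m : (0 < m)%N -> h (x ^+ m)%g = 0 -> h x = 0.
Proof.
move=> m0; rewrite additive_funX => /eqP; rewrite mulf_eq0 pnatr_eq0.
by rewrite gtn_eqF //= => /eqP.
Qed.

End Theory.

(** The graph of an additive map defined on a subgroup of [A]. *)
Definition partial_functional (Gam : set (A * F)) := [/\ Gam (1%g, 0),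
  forall x y a b, Gam (x, a) -> Gam (y, b) -> Gam ((x * y)%g, a + b),
  forall x a, Gam (x, a) -> Gam (x^-1%g, - a) &
  forall a, Gam (1%g, a) -> a = 0].

Lemma partial_functionalX Gam x a m : partial_functional Gam ->
  Gam (x, a) -> Gam ((x ^+ m)%g, m%:R * a).
Proof.
case=> G1 GM _ _ Ga; elim: m => [|m IHm]; first by rewrite expg0 mul0r.
by rewrite expgS mulrSr mulrDl mul1r addrC; exact: GM.
Qed.

Lemma partial_functional_fun Gam x a b : partial_functional Gam ->
  Gam (x, a) -> Gam (x, b) -> a = b.
Proof.
case=> G1 GM GV Gf Ga Gb; apply/eqP; rewrite -subr_eq0; apply/eqP/Gf.
by rewrite -(mulgV x); apply: GM => //; exact: GV.
Qed.

(** The value [b] may be prescribed at [y] as soon as it agrees with the values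
    already taken at powers of [y]. *)
Lemma partial_functional_extend Gam y b : partial_functional Gam ->
  (forall m c, (0 < m)%N -> Gam ((y ^+ m)%g, c) -> c = m%:R * b) ->
  exists Gam', [/\ partial_functional Gam', Gam `<=` Gam' & Gam' (y, b)].
Proof.
move=> pG compat; have [G1 GM GV Gf] := pG.
exists [set p | exists m k z c, [/\ Gam (z, c), (p.1 * y ^+ m = z * y ^+ k)%g &
  p.2 + m%:R * b = c + k%:R * b]]; split; last first.
- exists 0%N, 1%N, 1%g, 0; split=> //=.
  by rewrite mul0r addr0 mul1r add0r.
- move=> [z c] Gz; exists 0%N, 0%N, z, c; split=> //=.
split.
- by exists 0%N, 0%N, 1%g, 0.
- move=> x1 x2 a1 a2 /= [m1 [k1 [z1 [c1 [Gz1 e1 f1]]]]].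
  move=> [m2 [k2 [z2 [c2 [Gz2 e2 f2]]]]].
  exists (m1 + m2)%N, (k1 + k2)%N, (z1 * z2)%g, (c1 + c2) => /=.
  split; first exact: GM.
    rewrite !expgnDr mulgA -(mulgA x1) (abA x2) mulgA e1 -(mulgA _ x2) e2.
    by rewrite -!mulgA; congr (_ * _)%g; rewrite !mulgA (abA _ z2).
  rewrite !natrD !mulrDl addrACA f1 f2; exact: addrACA.
- move=> x a /= [m [k [z [c [Gz e f]]]]].
  exists k, m, z^-1%g, (- c) => /=; split; first exact: GV.
    apply: (mulgI x); apply: (mulgI z); rewrite mulVKg -e.
    by rewrite (abA x (z^-1 * _)%g) -mulgA mulVKg; exact: abA.
  by apply: (addrI (a + c)); transitivity (c + k%:R * b); [ring|rewrite -f; ring].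
- move=> a /= [m [k [z [c [Gz e f]]]]].
  move: e; rewrite mul1g => e.
  have [km|mk] := leqP k m.
    have Gmk : Gam ((y ^+ (m - k))%g, c).
      suff -> : (y ^+ (m - k))%g = z by [].
      by rewrite expgnFr // e mulgK.
    have [m_eq|mk0] := posnP (m - k)%N.
      have c0 : c = 0 by apply: Gf; rewrite m_eq expg0 in Gmk.
      have mk : m = k by apply/eqP; rewrite eqn_leq km -subn_eq0 m_eq eqxx.
      by move: f; rewrite c0 mk => /addIr.
    move: f; rewrite (compat _ _ mk0 Gmk) -mulrDl -natrD subnK //.
    by rewrite -[RHS]add0r => /addIr.
  have Gkm : Gam ((y ^+ (k - m))%g, - c).
    suff -> : (y ^+ (k - m))%g = z^-1%g by exact: GV.
    apply: (mulgI z); rewrite expgnFr ?(ltnW mk) // mulgA -e mulgV mulgV //.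
  have km0 : (0 < k - m)%N by rewrite subn_gt0.
  have /eqP := compat _ _ km0 Gkm; rewrite eqr_oppLR => /eqP c_eq.
  move: f; rewrite c_eq natrB ?(ltnW mk) // mulrBl opprB subrK.
  by rewrite -[RHS]add0r => /addIr.
Qed.

(** Characteristic zero fields are divisible, hence injective, abelian groups:
    a point with no positive power in [D] is separated from [D]. *)
Lemma separating_functional (D : set A) (x : A) : is_subgroup D ->
  (forall m, (0 < m)%N -> ~ D (x ^+ m)%g) ->
  exists h : A -> F, [/\ additive_fun h, forall d, D d -> h d = 0 & h x = 1].
Proof.
move=> [D1 DM DV] xD.
pose P := [set Gam | [/\ partial_functional Gam, D `<=` [set d | Gam (d, 0)] &
                         Gam (x, 1)]].
have pD : partial_functional [set p | D p.1 /\ p.2 = 0].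
  split=> [|y z a b /= [Dy ->] [Dz ->]|y a /= [Dy ->]|a /= []] //.
    by split; [exact: DM|rewrite addr0].
  by split; [exact: DV|rewrite oppr0].
have [|Gam0 [pG0 DG0 G0x]] := partial_functional_extend (y := x) (b := 1) pD.
  by move=> m c m0 /= [/(xD m m0)].
have [|||Gam [pG DG Gx] maxG] := @Zorn_maximal_set _ P Gam0.
- by exists (x, 1).
- by split=> // d Dd; apply: DG0.
- move=> Fam [Gam1 FG1] FP totF; have [pG1 DG1 G1x] := FP _ FG1.
  split; last by exists Gam1.
    split; first by exists Gam1 => //; case: pG1.
    + move=> y z a b [X FX Xy] [Y FY Yz].
      have [XY|YX] := totF _ _ FX FY.
        by exists Y => //; have [[_ YM _ _] _ _] := FP _ FY; apply: YM => //; exact: XY.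
      by exists X => //; have [[_ XM _ _] _ _] := FP _ FX; apply: XM => //; exact: YX.
    + move=> y a [X FX Xy]; exists X => //; have [[_ _ XV _] _ _] := FP _ FX.
      exact: XV.
    + by move=> a [X FX Xa]; have [[_ _ _ Xf] _ _] := FP _ FX; exact: Xf.
  by move=> d Dd; exists Gam1 => //; exact: DG1.
have totG y : exists a, Gam (y, a).
  (* If some power of y already has a value, division by the exponent
     dictates the value at y; otherwise 0 will do. *)
  have [b bP] : exists b, forall m c, (0 < m)%N -> Gam ((y ^+ m)%g, c) -> c = m%:R * b.
    have [[m [c [m0 Gm]]]|no] := pselect (exists m c, (0 < m)%N /\ Gam ((y ^+ m)%g, c)).
      exists (c / m%:R) => k d k0 Gk.
      have m_neq0 : m%:R != 0 :> F by rewrite pnatr_eq0 -lt0n.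
      have := partial_functionalX m pG Gk; rewrite -expgnA mulnC expgnA => Gkm.
      have := partial_functional_fun pG Gkm (partial_functionalX k pG Gm) => e.
      by apply: (mulfI m_neq0); rewrite e mulrCA (mulrCA m%:R) divff // mulr1.
    by exists 0 => m c m0 Gm; case: no; exists m, c.
  have [Gam' [pG' GG' G'y]] := partial_functional_extend pG bP.
  exists b; apply: (maxG Gam' _ GG' (y, b) G'y).
  by split=> // [d Dd|]; apply: GG' => //; exact: DG.
have [h hP] := choice totG.
exists h; split.
- move=> y z; apply: (partial_functional_fun pG (hP _) _).
  by case: pG => _ GM _ _; exact: GM.
- by move=> d Dd; apply: (partial_functional_fun pG (hP _) _); exact: DG.
- exact: (partial_functional_fun pG (hP _) Gx).
Qed.

End Functionals.

(** For abelian [A]: the rational vector space [Q (x) A] is finite-dimensional. *)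
Definition finite_rank (A : groupType) :=
  exists bs : seq A, forall x, exists2 m, (0 < m)%N & generated_by [set` bs] (x ^+ m)%g.

(** A point with no power in the subgroup generated by [bs] would be seen by a
    functional vanishing on [bs]. *)
Lemma finite_rank_detect (A : groupType) (F : numFieldType) (bs : seq A) :
  abelian_group A ->
  (forall h : A -> F, additive_fun h -> (forall b, b \in bs -> h b = 0) ->
     forall x, h x = 0) ->
  finite_rank A.
Proof.
move=> abA detect; exists bs => x; apply: contrapT => xP.
have [|h [hD hbs /eqP]] := separating_functional F abA
    (generated_subgroup [set` bs]) (x := x).
  by move=> m m0 xm; apply: xP; exists m.
rewrite (detect h hD) ?(eq_sym 0) ?oner_eq0 // => b bbs; apply: hbs.
exact: sub_generated.
Qed.

Lemma finite_rank_vanish (A : groupType) (F : numFieldType) (bs : seq A) :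
  (forall x, exists2 m, (0 < m)%N & generated_by [set` bs] (x ^+ m)%g) ->
  forall h : A -> F, additive_fun h -> (forall b, b \in bs -> h b = 0) ->
  forall x, h x = 0.
Proof.
move=> bsP h hD hbs x; have [m m0 xm] := bsP x.
apply: (additive_ker_root hD m0); move: (x ^+ m)%g xm.
by apply: generated_min; [exact: additive_ker_subgroup|exact: hbs].
Qed.

(** * Common eigenfunctionals of commuting operators *)

Section PolynomialAction.
Variables (F : fieldType) (V : lmodType F) (f : {linear V -> V}).

Definition poly_act (p : {poly F}) (v : V) := \sum_(i < size p) p`_i *: iter i f v.

Lemma poly_act_wide n (p : {poly F}) v : (size p <= n)%N ->
  poly_act p v = \sum_(i < n) p`_i *: iter i f v.
Proof.
move=> pn; rewrite [LHS](big_ord_widen n (fun i => p`_i *: iter i f v)) //.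
rewrite big_mkcond; apply: eq_bigr => i _; case: ltnP => // /(nth_default 0) ->.
by rewrite scale0r.
Qed.

Lemma poly_actD p q v : poly_act (p + q) v = poly_act p v + poly_act q v.
Proof.
have := size_polyD p q; set n := maxn _ _ => le_n.
rewrite (poly_act_wide v le_n) (@poly_act_wide n p) ?leq_maxl //.
rewrite (@poly_act_wide n q) ?leq_maxr // -big_split.
by apply: eq_bigr => i _; rewrite coefD scalerDl.
Qed.

Lemma poly_actZ a p v : poly_act (a *: p) v = a *: poly_act p v.
Proof.
rewrite (poly_act_wide v (size_scale_leq a p)) scaler_sumr.
by apply: eq_bigr => i _; rewrite coefZ scalerA.
Qed.

Lemma poly_act0 v : poly_act 0 v = 0.
Proof. by rewrite /poly_act size_poly0 big_ord0. Qed.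

Lemma poly_act_sum (I : finType) (P : pred I) (q : I -> {poly F}) v :
  poly_act (\sum_(i | P i) q i) v = \sum_(i | P i) poly_act (q i) v.
Proof.
by apply: (big_morph (poly_act^~ v)) => [p p'|]; [exact: poly_actD|exact: poly_act0].
Qed.

Lemma poly_actC a v : poly_act a%:P v = a *: v.
Proof.
by rewrite (poly_act_wide v (size_polyC_leq1 a)) big_ord1 coefC.
Qed.

Lemma poly_actMX p v : poly_act (p * 'X) v = poly_act p (f v).
Proof.
have le_n : (size (p * 'X)%R <= (size p).+1)%N.
  have [->|p0] := eqVneq p 0; first by rewrite mul0r size_poly0.
  by rewrite size_mulX.
rewrite (poly_act_wide v le_n) big_ord_recl coefMX scale0r add0r.
by apply: eq_bigr => i _; rewrite coefMX /= -iterS iterSr.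
Qed.

Lemma poly_actP p : linear (poly_act p).
Proof.
move=> a u v; rewrite /poly_act scaler_sumr -big_split; apply: eq_bigr => i _ /=.
rewrite scalerA mulrC -scalerA -scalerDr; congr (_ *: _).
by elim: (i : nat) => //= k ->; rewrite linearP.
Qed.

HB.instance Definition _ p := GRing.isLinear.Build F V V _ (poly_act p) (@poly_actP p).

Lemma poly_act_comm (g : {linear V -> V}) p v :
  (forall u, f (g u) = g (f u)) -> poly_act p (g v) = g (poly_act p v).
Proof.
move=> fg; rewrite /poly_act linear_sum; apply: eq_bigr => i _; rewrite linearZ.
by congr (_ *: _); elim: (i : nat) => //= k ->.
Qed.

Lemma poly_actM p q v : poly_act (p * q) v = poly_act p (poly_act q v).
Proof.
elim/poly_ind: p v => [|p a IHp] v; first by rewrite mul0r !poly_act0.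
rewrite mulrDl poly_actD mul_polyC poly_actZ -mulrA ['X * q]mulrC mulrA.
rewrite !poly_actMX IHp poly_actD poly_actMX poly_actC.
by rewrite poly_act_comm.
Qed.

Lemma poly_act_XsubC a v : poly_act ('X - a%:P) v = f v - a *: v.
Proof.
by rewrite -['X]mul1r poly_actD poly_actMX -polyCN !poly_actC scale1r scaleNr.
Qed.

Lemma poly_actX p k v : poly_act (p ^+ k) v = iter k (poly_act p) v.
Proof.
elim: k v => [|k IHk] v; first by rewrite expr0 poly_actC scale1r.
by rewrite exprS poly_actM IHk.
Qed.

End PolynomialAction.

Section StableSubspaces.
Variables (F : fieldType) (V : lmodType F) (I : Type) (t : I -> {linear V -> V}).
Implicit Type W : set V.

Definition stable_subspace W :=
  is_submodule W /\ forall i v, W v -> W (t i v).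

Lemma stable_poly_act W i p v : stable_subspace W -> W v -> W (poly_act (t i) p v).
Proof.
move=> [subW tW] Wv; rewrite /poly_act; elim/big_ind: _.
- exact: (submod0 (Submodule subW)).
- exact: (submodD (W := Submodule subW)).
- move=> k _; apply: (submodZ (W := Submodule subW)).
  by elim: (k : nat) => //= m; exact: tW.
Qed.

End StableSubspaces.

Section CommonEigenfunctional.
Variables (C : numClosedFieldType) (V : lmodType C).
Variables (I : Type) (t : I -> {linear V -> V}).
Hypothesis uncountableC : ~ countable [set: C].
Hypothesis tC : forall i j v, t i (t j v) = t j (t i v).
Variables (e : nat -> V) (gs : seq V).
Hypothesis e_span : forall v, exists n, exists c : 'I_n -> C,
  v = \sum_(k < n) c k *: e k.
Hypothesis gs_gen : forall W : set V, stable_subspace t W ->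
  (forall v, v \in gs -> W v) -> forall v, W v.
Variables (i0 : I) (p : {poly C}).
Let f := poly_act (t i0) p.

(** The stable subspaces modulo which [f] is not nilpotent. *)
Definition avoiding (W : set V) :=
  stable_subspace t W /\ forall k, exists v, ~ W (iter k f v).

Lemma act_comm i q j v : poly_act (t i) q (t j v) = t j (poly_act (t i) q v).
Proof. by apply: poly_act_comm => u; exact: tC. Qed.

Lemma iterf_act k : iter k f = poly_act (t i0) (p ^+ k).
Proof. by apply/funext => v; rewrite poly_actX. Qed.

(** Finite generation is what makes the union of a chain avoid every [f^k V]. *)
Lemma maximal_avoiding : (forall k, exists v, iter k f v != 0) ->
  exists2 W, avoiding W & forall W', avoiding W' -> W `<=` W' -> W' `<=` W.
Proof.
move=> fk_neq0; apply: (@Zorn_maximal_set _ _ [set 0]); first by exists 0.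
  split; last by move=> k; have [v /eqP] := fk_neq0 k; exists v.
  split=> [|i v /= ->]; last by rewrite linear0.
  by split=> // a u v /= -> ->; rewrite scaler0 addr0.
move=> Fam [W1 FW1] FP totF.
have subU : stable_subspace t (\bigcup_(W in Fam) W).
  split; first split.
  - by exists W1 => //; have [[[]]] := FP _ FW1.
  - move=> a u v [X FX Xu] [Y FY Yv]; have [XY|YX] := totF _ _ FX FY.
      exists Y => //; have [[[_ subY] _] _] := FP _ FY; apply: subY => //.
      exact: XY.
    exists X => //; have [[[_ subX] _] _] := FP _ FX; apply: subX => //.
    exact: YX.
  - by move=> i v [X FX Xv]; exists X => //; have [[_ tX] _] := FP _ FX; exact: tX.
split=> // k; apply: contrapT => /forallNP nok.
have [W FW Wgs] : exists2 W, Fam W & forall v, v \in gs -> W (iter k f v).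
  elim: (gs) => [|v s [W FW Ws]]; first by exists W1.
  have /contrapT[X FX Xv] := nok v.
  have [WX|XW] := totF _ _ FW FX.
    exists X => // u; rewrite inE => /predU1P[-> //|us]; apply: WX; exact: Ws.
  by exists W => // u; rewrite inE => /predU1P[->|/Ws //]; exact: XW.
have [stW /(_ k)[v nWv]] := FP _ FW; apply: nWv; have [subW tW] := stW.
apply: (gs_gen (W := [set v | W (iter k f v)])) => //; rewrite iterf_act.
split=> [|i u /=]; last by rewrite act_comm; exact: tW.
split=> /= [|a u w]; rewrite ?linear0 ?linearP; first by case: subW.
by case: subW => _; apply.
Qed.

Section Maximal.
Variable W : set V.
Hypothesis avW : avoiding W.
Hypothesis maxW : forall W', avoiding W' -> W `<=` W' -> W' `<=` W.

Let stW : stable_subspace t W. Proof. by case: avW. Qed.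
Let subW : is_submodule W. Proof. by case: stW. Qed.
Let tW i v : W v -> W (t i v). Proof. by case: stW => _; apply. Qed.
Let W0 : W 0. Proof. by case: subW. Qed.
Let WD u v : W u -> W v -> W (u + v).
Proof. exact: (submodD (W := Submodule subW)). Qed.
Let WB u v : W u -> W v -> W (u - v).
Proof. exact: (submodB (W := Submodule subW)). Qed.
Let WZ a v : W v -> W (a *: v).
Proof. exact: (submodZ (W := Submodule subW)). Qed.
Let Wsum (J : finType) (G : J -> V) : (forall j, W (G j)) -> W (\sum_j G j).
Proof. by move=> WG; elim/big_ind: _. Qed.

Lemma larger_absorbs W' : stable_subspace t W' -> W `<=` W' ->
  (exists2 v, W' v & ~ W v) -> exists k, forall v, W' (iter k f v).
Proof.
move=> stW' WW' [v W'v nWv]; apply: contrapT => /forallNP no.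
apply: nWv; apply: maxW W'v => //; split=> // k.
by have /existsNP := no k.
Qed.

(** Otherwise the preimage of [W] under [f] would be strictly larger than [W],
    hence contain some [f^k V], and [f] would be nilpotent modulo [W]. *)
Lemma cancel_f v : W (f v) -> W v.
Proof.
move=> Wfv; apply: contrapT => nWv.
have [|||k kP] := @larger_absorbs [set v | W (f v)].
- split=> [|i u /=]; last by rewrite /f act_comm; exact: tW.
  split=> /= [|a u w]; rewrite /f ?linear0 // linearP => Wu Ww.
  by apply: WD => //; exact: WZ.
- by move=> u Wu; exact: (stable_poly_act i0 p stW Wu).
- by exists v.
- by have [_ /(_ k.+1)[w]] := avW; rewrite iterS; apply; exact: kP.
Qed.

Lemma cancel_iterf k v : W (iter k f v) -> W v.
Proof. by elim: k => //= k IHk /cancel_f. Qed.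

Section OneOperator.
Variable i : I.

(** A nonzero kernel of [t i - c] modulo [W] contains some [f^k V]; as [f] is
    injective and commutes with [t i - c], the latter then vanishes. *)
Lemma not_scalar_cancel c : (exists v, ~ W (t i v - c *: v)) ->
  forall v, W (t i v - c *: v) -> W v.
Proof.
move=> [w nw] v Wv; apply: contrapT => nWv; apply: nw.
have [|||k kP] := @larger_absorbs [set v | W (t i v - c *: v)].
- split=> [|j u /=].
    split=> /= [|a u u']; first by rewrite linear0 scaler0 subr0.
    rewrite linearP scalerDr opprD addrACA scalerA mulrC -scalerA -scalerBr.
    by move=> Wu Wu'; apply: WD => //; exact: WZ.
  by rewrite tC -linearZ -linearB; exact: tW.
- by move=> u Wu; apply: WB; [exact: tW|exact: WZ].
- by exists v.
- apply: (@cancel_iterf k).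
  have := kP w; rewrite /= iterf_act -act_comm -linearZ -linearB //.
Qed.

(** The image of [t i - c] contains [f^k V] modulo [W], being a stable subspace
    larger than [W]. *)
Lemma not_scalar_hits c : (exists v, ~ W (t i v - c *: v)) ->
  exists k, forall v, exists w, W (iter k f v - (t i w - c *: w)).
Proof.
move=> nsc; have [u nWu] : exists u, ~ W u.
  by have [w nw] := nsc; exists (t i w - c *: w).
have [|||k kP] := @larger_absorbs [set v | exists w, W (v - (t i w - c *: w))].
- split=> [|j v /= [w Ww]].
    split=> /= [|a v v' [w Ww] [w' Ww']].
      by exists 0; rewrite linear0 scaler0 !subr0.
    exists (a *: w + w'); move: Ww Ww'; rewrite -!poly_act_XsubC linearP => Ww Ww'.
    by rewrite opprD addrACA -scalerBr; apply: WD => //; exact: WZ.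
  exists (t j w); rewrite tC -linearZ -!linearB; exact: tW.
- by move=> v Wv; exists 0; rewrite linear0 scaler0 !subr0.
- exists (t i u - c *: u); first by exists u; rewrite subrr.
  by move=> Wu; apply: nWu; exact: not_scalar_cancel Wu.
- by exists k => v; have [w] := kP v; exists w.
Qed.

(** If [t i] were not a scalar modulo the maximal subspace, then [t i - c]
    would be almost invertible for each of the uncountably many [c]. In a space
    of countable dimension the partial inverses of a single vector satisfy a
    linear relation; cleared of denominators, it is a polynomial in [t i] which
    kills that vector, although its linear factors are all injective. *)
Lemma scalar_mod : exists c, forall v, W (t i v - c *: v).
Proof.
apply: contrapT => /forallNP nsc'.
have nsc c : exists v, ~ W (t i v - c *: v) by apply/existsNP; exact: nsc'.
have [_ /(_ 0%N)[u /= nWu]] := avW.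
pose S (kn : nat * nat) := [set c | exists a : 'I_kn.2 -> C,
  W (iter kn.1 f u - (t i (\sum_j a j *: e j) - c *: \sum_j a j *: e j))].
(* The exponent k and the number n of basis vectors involved are the same for
   infinitely many c, by uncountability of the field. *)
have [[k n] Sinf] : exists kn, infinite_set (S kn).
  apply: contrapT => /forallNP Sfin; apply: uncountableC.
  have <- : \bigcup_(kn in [set: nat * nat]) S kn = [set: C].
    apply/seteqP; split=> // c _.
    have [k /(_ u)[w Ww]] := not_scalar_hits (nsc c).
    have [n [a w_eq]] := e_span w; exists (k, n) => //; exists a.
    by rewrite -w_eq.
  apply: bigcup_countable => // kn _; apply: finite_set_countable.
  by apply: contrapT; exact: Sfin.
have [B BS Bn] := infinite_set_fset n.+1 Sinf.
pose c (l : 'I_n.+1) : C := nth 0 (finmap.enum_fset B) l.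
have c_inj : injective c.
  move=> l l' /eqP; rewrite nth_uniq ?finmap.fset_uniq //;
    try exact: leq_trans (ltn_ord _) Bn.
  by move/eqP/val_inj.
have /choice[a aP] : forall l : 'I_n.+1, exists a : 'I_n -> C,
    W (iter k f u - (t i (\sum_j a j *: e j) - c l *: \sum_j a j *: e j)).
  by move=> l; apply: BS; apply: mem_nth; exact: leq_trans (ltn_ord _) Bn.
pose w l := \sum_j a l j *: e j.
pose M := \matrix_(l < n.+1, j < n) a l j.
have [al al_neq0 alM] : exists2 al : 'rV[C]_n.+1, al != 0 & al *m M = 0.
  have : kermx M != 0.
    rewrite -mxrank_eq0 mxrank_ker subn_eq0 -ltnNge ltnS.
    exact: rank_leq_col.
  by case/rowV0Pn => al /sub_kermxP alM al0; exists al.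
have sumw : \sum_l al 0 l *: w l = 0.
  rewrite /w; under eq_bigr do rewrite scaler_sumr.
  rewrite exchange_big big1 // => j _.
  under eq_bigr do rewrite scalerA.
  rewrite -scaler_suml; have /matrixP/(_ 0 j) := alM; rewrite !mxE => al0.
  have -> : \sum_l al 0 l * a l j = 0.
    by rewrite -[RHS]al0; apply: eq_bigr => l _; rewrite mxE.
  by rewrite scale0r.
(* The relation between the w l, multiplied by the product of all t i - c l:
   each term loses one factor since (t i - c l) (w l) = f^k u modulo W. *)
pose rest l := \prod_(l' | l' != l) ('X - (c l')%:P).
pose g := \sum_l al 0 l *: rest l.
have g_neq0 : g != 0.
  have [l0 al0] : exists l0, al 0 l0 != 0.
    apply: contrapT => /forallNP al0; move/eqP: al_neq0; apply.
    by apply/rowP => l; rewrite mxE; apply/eqP/negPn/negP; exact: al0.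
  suff : g.[c l0] != 0 by apply: contra => /eqP ->; rewrite horner0.
  rewrite /g horner_sum (bigD1 l0) //= big1 ?addr0 => [|l ll0].
    rewrite hornerZ mulf_neq0 // horner_prod prodf_seq_neq0; apply/allP => l _.
    apply/implyP => ll0; rewrite hornerXsubC subr_eq0; apply: contra ll0.
    by move/eqP/c_inj => ->.
  rewrite hornerZ horner_prod (bigD1 l0) 1?eq_sym //= hornerXsubC subrr mul0r.
  by rewrite mulr0.
have Wg : W (poly_act (t i) g (iter k f u)).
  have -> : poly_act (t i) g (iter k f u) =
      \sum_l al 0 l *: poly_act (t i) (rest l)
        (iter k f u - (t i (w l) - c l *: w l)).
    rewrite /g poly_act_sum.
    under [RHS]eq_bigr do rewrite linearB scalerBr.
    rewrite big_split /= sumrN [X in _ - X](_ : _ = 0) ?subr0.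
      by apply: eq_bigr => l _; rewrite poly_actZ.
    transitivity (poly_act (t i) (\prod_l ('X - (c l)%:P)) (\sum_l al 0 l *: w l)).
      rewrite linear_sum; apply: eq_bigr => l _; rewrite [RHS]linearZ; congr (_ *: _).
      rewrite -poly_act_XsubC -poly_actM; congr (poly_act _ _ _).
      by rewrite [RHS](bigD1 l) //= mulrC.
    by rewrite sumw linear0.
  by apply: Wsum => l; apply: WZ; exact: (stable_poly_act i _ stW (aP l)).
apply: nWu; apply: (@cancel_iterf k).
move: Wg; have [rs ->] := closed_field_poly_normal g.
rewrite poly_actZ => /(WZ (lead_coef g)^-1).
rewrite scalerA mulVf ?lead_coef_eq0 // scale1r.
move: (iter k f u) => v; elim: rs v => [|r rs IHrs] v.
  by rewrite big_nil poly_actC scale1r.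
rewrite big_cons mulrC poly_actM poly_act_XsubC => /IHrs.
exact: not_scalar_cancel.
Qed.

End OneOperator.

Lemma poly_act_scalar_mod i c q v :
  (forall v, W (t i v - c *: v)) -> W (poly_act (t i) q v - q.[c] *: v).
Proof.
move=> tc; elim/poly_ind: q => [|q a IHq].
  by rewrite poly_act0 horner0 scale0r subr0.
rewrite poly_actD poly_actMX poly_actC hornerMXaddC scalerDl.
rewrite [_ *: v + a *: v]addrC addrKA.
rewrite -[poly_act _ _ _](subrK (poly_act (t i) q (c *: v))) -linearB -addrA.
apply: WD; first exact: (stable_poly_act i q stW (tc v)).
by rewrite linearZ [q.[c] * c]mulrC -scalerA -scalerBr; exact: WZ.
Qed.

End Maximal.

(** A form of the Nullstellensatz: an operator [p(t i0)] that is not nilpotent is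
    nonzero at some point of the common spectrum of the operators [t i]. *)
Lemma common_eigenfunctional : (forall k, exists v, iter k f v != 0) ->
  exists (phi : V -> C) (rho : I -> C), [/\
    forall a u v, phi (a *: u + v) = a * phi u + phi v,
    exists v, phi v != 0, forall i v, phi (t i v) = rho i * phi v &
    p.[rho i0] != 0].
Proof.
move=> /maximal_avoiding [W avW maxW]; have [stW noW] := avW.
have [subW tW] := stW.
have WD := submodD (W := Submodule subW); have WZ := submodZ (W := Submodule subW).
have WB := submodB (W := Submodule subW); rewrite /= in WD WZ WB.
have W0 : W 0 by case: subW.
have [rho rhoP] := choice (scalar_mod avW maxW).
have fP v : W (f v - p.[rho i0] *: v) by apply: poly_act_scalar_mod.
have prho : p.[rho i0] != 0.
  apply/eqP => prho0; have [v] := noW 1%N; apply.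
  by have := fP v; rewrite prho0 scale0r subr0.
have [u nWu] := noW 0%N; rewrite /= in nWu.
(* By maximality W has codimension one: W + C u absorbs some f^k V, and f
   is a nonzero scalar modulo W. *)
have [k kP] : exists k, forall v, exists a, W (iter k f v - a *: u).
  apply: (larger_absorbs maxW (W' := [set v | exists a, W (v - a *: u)])).
  - split=> [|i v /= [a Wa]].
      split=> [|b v v' [a Wa] [a' Wa']] /=; first by exists 0; rewrite scale0r subr0.
      exists (b * a + a'); rewrite scalerDl -scalerA opprD addrACA -scalerBr.
      by apply: WD => //; exact: WZ.
    exists (a * rho i); rewrite -[t i v](subrK (t i (a *: u))) -linearB -addrA.
    apply: WD; first exact: tW.
    by rewrite linearZ -scalerA -scalerBr; apply: WZ; exact: rhoP.
  - by move=> v Wv; exists 0; rewrite scale0r subr0.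
  - by exists u => //; exists 1; rewrite scale1r subrr.
have /choice[phi phiP] : forall v, exists a, W (v - a *: u).
  elim: k kP => [//|k IHk] kP; apply: IHk => v.
  have [a Wa] := kP v; exists (a / p.[rho i0]).
  have := WZ (p.[rho i0])^-1 _ (WB _ _ Wa (fP (iter k f v))).
  rewrite iterS opprD opprK addrACA subrr add0r scalerDr scalerN !scalerA.
  by rewrite mulVf // scale1r addrC mulrC.
have phi_uniq v a : W (v - a *: u) -> phi v = a.
  move=> Wa; apply/eqP; rewrite -subr_eq0; apply/eqP; apply: contrapT => /eqP ne.
  apply: nWu; have := WZ (phi v - a)^-1 _ (WB _ _ Wa (phiP v)).
  by rewrite opprD opprK addrACA subrr add0r addrC -scalerBl scalerA mulVf // scale1r.
exists phi, rho; split=> //.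
- move=> a v w /=; apply: phi_uniq.
  by rewrite scalerDl -scalerA opprD addrACA -scalerBr; apply: WD => //; exact: WZ.
- by exists u; rewrite (phi_uniq u 1) ?oner_neq0 // scale1r subrr.
- move=> i v; apply: phi_uniq; rewrite -(subrK (rho i *: v) (t i v)) -addrA.
  by apply: WD => //; rewrite -scalerA -scalerBr; exact: WZ.
Qed.

End CommonEigenfunctional.

(** * Extension of scalars of an abelian group *)

Section ExtensionOfScalars.
Variables (F : fieldType) (A : groupType).

Definition tens_relations : set {freeg A / F} :=
  [set r | exists a b : A, r = << (a * b)%g >> - << a >> - << b >>].

(** [F (x)_Z A]; [tensQ] is the case of the rational numbers. *)
Definition tens : lmodType F := quotV (linear_span tens_relations).

Definition tens_in (a : A) : tens := quotV_proj _ << a >>.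

Lemma tens_inM a b : tens_in (a * b)%g = tens_in a + tens_in b.
Proof.
rewrite /tens_in -linearD; apply/quotV_projP => S [_]; apply.
by exists a, b; rewrite opprD addrA.
Qed.

Lemma tens_ind (S : set tens) : is_submodule S -> (forall a, S (tens_in a)) ->
  forall v, S v.
Proof.
move=> subS Sin; elim/quotV_ind=> u; rewrite -[u]freeg_sumE linear_sum.
elim/big_ind: _ => [||x _]; first exact: (submod0 (Submodule subS)).
  exact: (submodD (W := Submodule subS)).
rewrite -[coeff x u]mulr1 -freegZU linearZ.
by apply: (submodZ (W := Submodule subS)); exact: Sin.
Qed.

Lemma tens_in1 : tens_in 1%g = 0.
Proof. by apply: (addrI (tens_in 1%g)); rewrite -tens_inM mulg1 addr0. Qed.

Lemma tens_inV a : tens_in a^-1%g = - tens_in a.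
Proof. by apply: (addrI (tens_in a)); rewrite -tens_inM mulgV tens_in1 subrr. Qed.

Lemma tens_inX a m : tens_in (a ^+ m)%g = m%:R *: tens_in a.
Proof.
elim: m => [|m IHm]; first by rewrite expg0 tens_in1 scale0r.
by rewrite expgS tens_inM IHm mulrS scalerDl scale1r.
Qed.

Lemma tens_in_subgroup (S : set tens) : is_submodule S ->
  is_subgroup [set a | S (tens_in a)].
Proof.
move=> subS; split=> [|x y|x] /=.
- rewrite tens_in1; exact: (submod0 (Submodule subS)).
- rewrite tens_inM; exact: (submodD (W := Submodule subS)).
- rewrite tens_inV; exact: (submodN (W := Submodule subS)).
Qed.

Section Lift.
Variables (M : lmodType F) (h : A -> M).
Hypothesis hD : {morph h : x y / (x * y)%g >-> x + y}.

Lemma fglift_tens_relations u : linear_span tens_relations u -> fglift h u = 0.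
Proof.
move=> /(_ [set u | fglift h u = 0]); apply; split.
  exact: (ker_submodule (fglift h)).
move=> _ [a [b ->]] /=.
by rewrite !linearB /= !liftU !scale1r hD addrAC addrK subrr.
Qed.

Definition tens_lift (v : tens) : M := fglift h (repr v).

Lemma tens_lift_proj u : tens_lift (quotV_proj _ u) = fglift h u.
Proof.
apply/eqP; rewrite -subr_eq0 -linearB; apply/eqP/fglift_tens_relations.
exact: quotV_repr_sub.
Qed.

Lemma tens_lift_in a : tens_lift (tens_in a) = h a.
Proof. by rewrite tens_lift_proj liftU scale1r. Qed.

Lemma tens_lift_linear : linear tens_lift.
Proof.
move=> a; elim/quotV_ind=> u; elim/quotV_ind=> v.
by rewrite -linearP !tens_lift_proj linearP.
Qed.

HB.instance Definition _ := GRing.isLinear.Build F tens M _ tens_lift tens_lift_linear.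

(** Given by a sealed witness, so that simplification does not unfold it. *)
Lemma tens_universal : {g : {linear tens -> M} | forall a, g (tens_in a) = h a}.
Proof. by exists tens_lift => a; exact: tens_lift_in. Qed.

End Lift.
End ExtensionOfScalars.

(** * Modules with finite support have finite rank *)

Section FiniteSupport.
Variables (C : numClosedFieldType) (A G : groupType) (act : G -> A -> A).
Hypothesis uncountableC : ~ countable [set: C].
Hypothesis abA : abelian_group A.
Hypothesis actM : forall g a b, act g (a * b)%g = (act g a * act g b)%g.
Hypothesis act1 : forall a, act 1%g a = a.
Hypothesis act_mul : forall g h a, act (g * h)%g a = act g (act h a).
Hypothesis actC : forall g h a, act g (act h a) = act h (act g a).

Definition eigenfunctional (rho : G -> C) (phi : A -> C) := [/\ additive_fun phi,
  exists a, phi a != 0 & forall g a, phi (act g a) = rho g * phi a].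

Variable enumA : nat -> A.
Hypothesis enumA_surj : forall a, exists n, enumA n = a.
Variable b0 : seq A.
Hypothesis b0_gen : forall S : set A, is_subgroup S ->
  (forall a m, (0 < m)%N -> S (a ^+ m)%g -> S a) ->
  (forall g a, S a -> S (act g a)) -> (forall b, b \in b0 -> S b) ->
  forall a, S a.
Variable gs : seq G.
Hypothesis gs_gen : forall S : set G, S 1%g ->
  (forall g x, g \in gs -> S x -> S (g * x)%g) -> forall x, S x.
Variable L : G -> seq C.
Hypothesis suppL : forall rho phi, eigenfunctional rho phi -> forall g, rho g \in L g.

Lemma act_tens_additive g :
  {morph (fun a => tens_in C (act g a)) : x y / (x * y)%g >-> x + y}.
Proof. by move=> a b; rewrite actM tens_inM. Qed.

Definition tens_act g : {linear tens C A -> tens C A} :=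
  sval (tens_universal (act_tens_additive g)).

Lemma tens_act_in g a : tens_act g (tens_in C a) = tens_in C (act g a).
Proof. exact: (svalP (tens_universal (act_tens_additive g))). Qed.

Lemma tens_act_comm g h v : tens_act g (tens_act h v) = tens_act h (tens_act g v).
Proof.
move: v; apply: (@tens_ind _ _ [set v | tens_act g (tens_act h v) =
  tens_act h (tens_act g v)]) => [|a]; last by rewrite /= !tens_act_in actC.
split=> [|a u v] /=; first by rewrite !linear0.
by rewrite !linearP => -> ->.
Qed.

Lemma tens_span v : exists n, exists c : 'I_n -> C,
  v = \sum_(k < n) c k *: tens_in C (enumA k).
Proof.
suff [n [c ->]] : exists n, exists c : nat -> C,
    v = \sum_(k < n) c k *: tens_in C (enumA k).
  by exists n, (c \o val).
move: v; apply: (@tens_ind _ _ [set v | exists n, exists c : nat -> C,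
   v = \sum_(k < n) c k *: tens_in C (enumA k)]) => [|a] /=.
  split=> [|a u v [m [c ->]] [n [d ->]]].
    by exists 0%N, (fun=> 0); rewrite big_ord0.
  exists (maxn m n),
    (fun k => a * (if (k < m)%N then c k else 0) + if (k < n)%N then d k else 0).
  rewrite (big_ord_widen (maxn m n) (fun k => c k *: tens_in C (enumA k))) ?leq_maxl //.
  rewrite (big_ord_widen (maxn m n) (fun k => d k *: tens_in C (enumA k))) ?leq_maxr //.
  rewrite big_mkcond [X in _ + X]big_mkcond scaler_sumr -big_split /=.
  apply: eq_bigr => k _; rewrite scalerDl -scalerA.
  by congr (_ *: _ + _); case: ifP; rewrite ?scale0r.
have [n <-] := enumA_surj a; exists n.+1, (fun k => (k == n)%:R).
rewrite big_ord_recr /= eqxx scale1r big1 ?add0r // => k _.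
by rewrite ltn_eqF // scale0r.
Qed.

Lemma tens_fg (W : set (tens C A)) : stable_subspace tens_act W ->
  (forall v, v \in [seq tens_in C b | b <- b0] -> W v) -> forall v, W v.
Proof.
move=> [subW tW] Wb0; apply: tens_ind => //.
apply: (b0_gen (S := [set a | W (tens_in C a)])).
- exact: tens_in_subgroup.
- move=> a m m0; rewrite /= tens_inX => Wm.
  rewrite -[tens_in C a](@scalerK _ _ m%:R) ?pnatr_eq0 -?lt0n //.
  exact: (submodZ (W := Submodule subW)).
- by move=> g a /= Wa; rewrite -tens_act_in; exact: tW.
- by move=> b bb0; apply: Wb0; exact: map_f.
Qed.

(** The polynomial vanishing at the values of the support at [g] is nilpotent
    on [C (x) A]: this is the Nullstellensatz for the commuting operators
    [tens_act]. *)
Lemma support_poly_nilpotent g :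
  exists k, forall v, poly_act (tens_act g) ((\prod_(c <- L g) ('X - c%:P)) ^+ k) v = 0.
Proof.
set p := \prod_(c <- L g) _; apply: contrapT => /forallNP no.
have [k|phi [rho [phiP [v phiv] phit prho]]] :=
    @common_eigenfunctional C (tens C A) G tens_act uncountableC tens_act_comm
      (fun k => tens_in C (enumA k)) _ tens_span tens_fg g p.
  have /existsNP[v /eqP nv] := no k; exists v; rewrite -poly_actX //.
have phi0 : phi 0 = 0.
  have := phiP 1 0 0; rewrite scale1r mul1r addr0 => /eqP.
  by rewrite -subr_eq subrr eq_sym => /eqP.
have phiD u w : phi (u + w) = phi u + phi w.
  by have := phiP 1 u w; rewrite scale1r mul1r.
suff : eigenfunctional rho (fun a => phi (tens_in C a)).
  move=> /suppL /(_ g) rhoL; move/negP: prho; apply.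
  by rewrite -rootE root_prod_XsubC.
split.
- by move=> a b /=; rewrite tens_inM phiD.
- apply: contrapT => /forallNP phi_in; move/eqP: phiv; apply; move: v.
  apply: (@tens_ind _ _ [set v | phi v = 0]) => [|a].
    by split=> //= a u w; rewrite phiP => -> ->; rewrite mulr0 addr0.
  by apply/eqP/negPn/negP; exact: phi_in.
- by move=> h a /=; rewrite -tens_act_in phit.
Qed.

(** An additive functional extends to a linear one on [C (x) A], where a monic
    polynomial of [g] vanishes. *)
Lemma monic_recurrence g : exists2 q : {poly C}, q \is monic &
  forall h, additive_fun h -> forall a,
    \sum_(i < size q) q`_i * h (act (g ^+ i)%g a) = 0 :> C.
Proof.
have [k kP] := support_poly_nilpotent g.
exists ((\prod_(c <- L g) ('X - c%:P)) ^+ k).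
  by apply: monic_exp; exact: monic_prod_XsubC.
move=> h hD a; have [hC hCP] := tens_universal (M := C^o) hD.
have := congr1 hC (kP (tens_in C a)).
rewrite linear0 linear_sum => h0; rewrite -[RHS]h0; apply: eq_bigr => i _.
rewrite linearZ; congr (_ * _).
suff -> : iter i (tens_act g) (tens_in C a) = tens_in C (act (g ^+ i)%g a).
  by rewrite hCP.
elim: (i : nat) => [|m IHm]; first by rewrite expg0 act1.
by rewrite iterS IHm tens_act_in -act_mul -expgS.
Qed.

Lemma orbit_vanish g : exists d, forall h : A -> C, additive_fun h -> forall a,
  (forall e, (e < d)%N -> h (act (g ^+ e)%g a) = 0) ->
  forall e, h (act (g ^+ e)%g a) = 0.
Proof.
have [q q_monic qP] := monic_recurrence g; exists (size q).-1 => h hD a h_lt e.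
elim/ltn_ind: e => e IHe; have [/h_lt //|de] := ltnP e (size q).-1.
have q_gt0 : (0 < size q)%N by rewrite size_poly_gt0 monic_neq0.
have := qP h hD (act (g ^+ (e - (size q).-1))%g a).
rewrite -(prednK q_gt0) big_ord_recr /= big1 ?add0r => [|i _].
  rewrite -act_mul -expgnDr addnC subnK //.
  by have /monicP := q_monic; rewrite /lead_coef => ->; rewrite mul1r.
by rewrite -act_mul -expgnDr IHe ?mulr0 // -[X in (_ < X)%N](subnKC de) ltn_add2r.
Qed.

(** The root closure of the subgroup generated by [bs], described by duality. *)
Definition killed (bs : seq A) (a : A) :=
  forall h : A -> C, additive_fun h -> (forall b, b \in bs -> h b = 0) -> h a = 0.

(** The orbit of a finite set under one more generator is controlled by finitely
    many of its translates, which are adjoined to the set. *)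
Lemma stable_killed (l : seq G) : exists bs, (forall b, b \in b0 -> killed bs b) /\
  forall g a, g \in l -> killed bs a -> killed bs (act g a).
Proof.
elim: l => [|g l [bs [bsb0 bsl]]].
  by exists b0; split=> // b bb0 h hD; apply.
have [d dP] := orbit_vanish g.
pose bs' := [seq act (g ^+ e)%g b | e <- iota 0 d, b <- bs].
have actD (h : A -> C) x : additive_fun h -> additive_fun (h \o act x).
  by move=> hD a b /=; rewrite actM hD.
have orbit (h : A -> C) b e : additive_fun h -> (forall b', b' \in bs' -> h b' = 0) ->
    b \in bs -> h (act (g ^+ e)%g b) = 0.
  move=> hD hbs' bbs; apply: (dP h hD b) => e' e'd; apply: hbs'.
  by apply/allpairsP; exists (e', b); rewrite mem_iota.
have killed_orbit (h : A -> C) a e : additive_fun h ->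
    (forall b', b' \in bs' -> h b' = 0) ->
    killed bs a -> h (act (g ^+ e)%g a) = 0.
  move=> hD hbs' ka; apply: (ka (h \o act (g ^+ e)%g)); first exact: actD.
  by move=> b bbs /=; exact: orbit.
exists bs'; split=> [b bb0 h hD hbs'|g' a].
  by rewrite -[b]act1; apply: (killed_orbit h b 0%N) => //; exact: bsb0.
rewrite inE => g'l ka h hD hbs'.
apply: (ka (h \o act g')) => [|b' /allpairsP[[e b] [_ bbs ->]] /=]; first exact: actD.
move: g'l => /predU1P[->|g'l].
  by rewrite -act_mul -expgS; exact: orbit.
rewrite actC; apply: killed_orbit => //.
by apply: bsl => // h' hD' hbs; exact: hbs.
Qed.

(** The points killed by all functionals that vanish on the finite set given by
    [stable_killed] form a stable, root-closed subgroup containing the generators;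
    so this set detects all functionals. *)
Theorem finite_support_finite_rank : finite_rank A.
Proof.
have [bs [bsb0 bsgs]] := stable_killed gs.
apply: (finite_rank_detect (F := C) (bs := bs)) => // h hD hbs a.
suff : killed bs a by apply.
move: a; apply: b0_gen => //.
- split=> [h' hD' _|x y kx ky h' hD' hbs'|x kx h' hD' hbs'].
  + exact: additive_fun1.
  + by rewrite hD' kx // ky // addr0.
  + by rewrite additive_funV // kx // oppr0.
- move=> a m m0 ka h' hD' hbs'; apply: (additive_ker_root hD' m0); exact: ka.
- move=> g; move: g.
  apply: (gs_gen (S := [set g | forall a, killed bs a -> killed bs (act g a)])).
    by move=> a; rewrite act1.
  by move=> g x ggs kx a ka; rewrite act_mul; apply: bsgs => //; exact: kx.
Qed.

End FiniteSupport.

(** * Dimensions and chains of subgroups *)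

Section Dimension.
Variables (F : fieldType) (V : lmodType F).

(** A vector occurring in a linear relation is redundant. *)
Lemma spanning_basis n (e : 'I_n -> V) :
  (forall v, exists c : 'I_n -> F, v = \sum_j c j *: e j) ->
  exists d, exists b : 'I_d -> V, is_basis b.
Proof.
elim: n e => [|n IHn] e e_span; last first.
  have [free|] := pselect (forall c, \sum_j c j *: e j = 0 -> forall j, c j = 0).
    exists n.+1, e => v; have [c ->] := e_span v.
    exists [ffun j => c j]; split; first by apply: eq_bigr => j _; rewrite ffunE.
    move=> c' /esym/eqP; rewrite -subr_eq0 -sumrB => /eqP c'c.
    apply/ffunP => j; rewrite ffunE; apply/esym/eqP; rewrite -subr_eq0; apply/eqP.
    apply: (free (fun j => c' j - c j)); rewrite -[RHS]c'c.
    by apply: eq_bigr => k _; rewrite scalerBl.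
  move=> /existsNP[c /not_implyP[c0 /existsNP[j0 /eqP cj0]]].
  apply: (IHn (e \o fintype.lift j0)) => v; have [a ->] := e_span v.
  exists (fun j => a (fintype.lift j0 j) - a j0 / c j0 * c (fintype.lift j0 j)).
  have /eqP : \sum_j c j *: e j = 0 by [].
  rewrite (bigD1_ord j0) //= addrC addr_eq0 => /eqP e_lift.
  rewrite (bigD1_ord j0) //=; under [RHS]eq_bigr do rewrite scalerBl -scalerA.
  rewrite sumrB -scaler_sumr e_lift scalerN opprK scalerA mulfVK // addrC //.
exists 0%N, e => v; have [c ->] := e_span v.
exists [ffun=> 0]; split; first by rewrite !big_ord0.
by move=> c' _; apply/ffunP => -[].
Qed.

Lemma dimension_fin n (e : 'I_n -> V) :
  (forall v, exists c : 'I_n -> F, v = \sum_j c j *: e j) ->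
  (dimension V < +oo)%E.
Proof.
move=> e_span; rewrite /dimension; case: pselect => [fd|[]].
  by rewrite ltry.
exact: spanning_basis e_span.
Qed.

Lemma dimension_trivial : (forall v : V, v = 0) -> dimension V = 0%E.
Proof.
move=> V0; rewrite /dimension; case: pselect => [fd|[]]; last first.
  by apply: (@spanning_basis 0 (fun=> 0)) => v; exists (fun=> 0); rewrite big_ord0.
case: (cid fd) => -[|d] [e be] //=; have [c [_ c_uniq]] := be 0.
have c_eq c' : c = c' by apply: c_uniq; exact/esym/V0.
have /ffunP/(_ ord0) : [ffun=> 0] = [ffun=> 1] :> {ffun 'I_d.+1 -> F}.
  exact: etrans (esym (c_eq _)) (c_eq _).
by rewrite !ffunE => /esym/eqP; rewrite oner_eq0.
Qed.

Lemma dimension_ge1 (v : V) : v != 0 -> (1 <= dimension V)%E.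
Proof.
move=> v0; rewrite /dimension; case: pselect => [fd|_]; last exact: leey.
case: (cid fd) => -[|d] [e be] /=; last by rewrite lee_fin.
by have [c [/eqP]] := be v; rewrite big_ord0 (negPf v0).
Qed.

End Dimension.

Lemma finite_rank_dimension (A : groupType) : finite_rank A ->
  (dimension (tensQ A) < +oo)%E.
Proof.
move=> [bs bsP]; pose e (j : 'I_(size bs)) := tens_in rat (nth 1%g bs j).
apply: (@dimension_fin _ _ _ e).
have span_sub : is_submodule [set v : tensQ A | exists c, v = \sum_j c j *: e j].
  split=> [|a u v [c ->] [d ->]] /=.
    by exists (fun=> 0); rewrite big1 // => j _; rewrite scale0r.
  exists (fun j => a * c j + d j); rewrite scaler_sumr -big_split.
  by apply: eq_bigr => j _; rewrite scalerDl scalerA.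
apply: (tens_ind span_sub) => x; have [m m0 xm] := bsP x.
rewrite -[tens_in rat x](@scalerK _ _ m%:R) ?pnatr_eq0 -?lt0n //.
apply: (submodZ (W := Submodule span_sub)); rewrite -tens_inX.
move: (x ^+ m)%g xm; apply: generated_min; first exact: tens_in_subgroup.
move=> b bbs /=; have ib : (index b bs < size bs)%N by rewrite index_mem.
exists (fun j => (j == Ordinal ib)%:R); rewrite (bigD1 (Ordinal ib)) //=.
rewrite eqxx scale1r big1 ?addr0 => [|j /negPf ->]; last by rewrite scale0r.
by rewrite /e nth_index.
Qed.

Lemma torsion_dimension (A : groupType) :
  (forall x : A, exists2 m, (0 < m)%N & x ^+ m = 1)%g ->
  dimension (tensQ A) = 0%E.
Proof.
move=> torA; apply: dimension_trivial; apply: (@tens_ind _ _ [set v | v = 0]).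
  by split=> //= a u v -> ->; rewrite scaler0 addr0.
move=> x; have [m m0 xm] := torA x.
rewrite /= -[tens_in rat x](@scalerK _ _ m%:R) ?pnatr_eq0 -?lt0n //.
by rewrite -tens_inX xm tens_in1 scaler0.
Qed.

(** Each strict inclusion [D n.+1 < D n] provides a functional vanishing on
    [D n.+1] but not on [D n]; such functionals are linearly independent, while
    a functional is determined by its values on finitely many points. *)
Lemma isolated_chain_stationary (A : groupType) (D : nat -> set A) :
  abelian_group A -> finite_rank A -> (forall n, is_subgroup (D n)) ->
  (forall n x m, (0 < m)%N -> D n (x ^+ m)%g -> D n x) ->
  (forall n, D n.+1 `<=` D n) ->
  exists N, forall n, (N <= n)%N -> D n `<=` D n.+1.
Proof.
move=> abA [bs bsP] subD rootD decD; apply: contrapT => /forallNP no.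
have decD' m n : (m <= n)%N -> D n `<=` D m.
  move=> /subnK <-; elim: (n - m)%N => // k IHk x /decD; exact: IHk.
have step N : exists nh : nat * (A -> rat) * A, [/\ (N <= nh.1.1)%N,
    additive_fun nh.1.2, forall x, D nh.1.1.+1 x -> nh.1.2 x = 0,
    D nh.1.1 nh.2 & nh.1.2 nh.2 = 1].
  have /existsNP[n /not_implyP[Nn /existsNP[x /not_implyP[Dx nDx]]]] := no N.
  have [|h [hD hK hx]] := @separating_functional A rat abA (D n.+1) x (subD _).
    by move=> m m0 /(rootD _ _ _ m0).
  by exists (n, h, x).
have [f fP] := choice step.
pose s := fix s k := (f (if k is k'.+1 then (s k').+1 else 0%N)).1.1.
pose g k := f (if k is k'.+1 then (s k').+1 else 0%N).
have sE k : (g k).1.1 = s k by case: k.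
have s_mono k l : (k < l)%N -> (s k < s l)%N.
  have s1 j : (s j < s j.+1)%N by have [] := fP (s j).+1.
  elim: l => // l IHl; rewrite ltnS leq_eqVlt => /predU1P[-> //|/IHl kl].
  exact: ltn_trans (s1 l).
have gP k : [/\ additive_fun (g k).1.2, forall x, D (s k).+1 x -> (g k).1.2 x = 0,
    D (s k) (g k).2 & (g k).1.2 (g k).2 = 1].
  by rewrite -sE /g; have [_] := fP (if k is k'.+1 then (s k').+1 else 0%N).
pose d := size bs.
pose M := \matrix_(k < d.+1, j < d) (g k).1.2 (nth 1%g bs j).
have [al al_neq0 alM] : exists2 al : 'rV[rat]_d.+1, al != 0 & al *m M = 0.
  have : kermx M != 0.
    by rewrite -mxrank_eq0 mxrank_ker subn_eq0 -ltnNge ltnS; exact: rank_leq_col.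
  by case/rowV0Pn => al /sub_kermxP alM al0; exists al.
pose H x := \sum_k al 0 k * (g k).1.2 x.
have HD : additive_fun H.
  move=> x y; rewrite /H -big_split; apply: eq_bigr => k _.
  by have [hD _ _ _] := gP k; rewrite hD mulrDr.
have H0 : forall x, H x = 0.
  apply: (finite_rank_vanish bsP HD) => b bbs.
  have ib : (index b bs < d)%N by rewrite index_mem.
  have /matrixP/(_ 0 (Ordinal ib)) := alM; rewrite !mxE => <-.
  by apply: eq_bigr => k _; rewrite mxE /= nth_index.
have [l0 al0] : exists l0, al 0 l0 != 0.
  apply: contrapT => /forallNP al0; move/eqP: al_neq0; apply.
  by apply/rowP => l; rewrite mxE; apply/eqP/negPn/negP; exact: al0.
(* In the relation sum_k al_k h_k = 0 evaluate at the point attached to the last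
   nonzero coefficient l: the functionals h_k with k < l vanish there. *)
case: (@arg_maxnP _ l0 (fun l => al 0 l != 0) val al0) => l all lmax.
move/eqP: all; apply; have [_ _ Dl hl] := gP l.
rewrite -[RHS](H0 (g l).2) /H (bigD1 l) //= hl mulr1 big1 ?addr0 // => k kl.
have [lk|kl'|/val_inj kl'] := ltngtP l k; last by rewrite kl' eqxx in kl.
  have /eqP -> : al 0 k == 0; last by rewrite mul0r.
  by apply/negPn/negP => /lmax; rewrite /= leqNgt lk.
have [_ hk _ _] := gP k; rewrite hk ?mulr0 //.
by apply: decD' Dl; exact: s_mono.
Qed.

Local Open Scope group_scope.

(** * Subquotients and the rational Alexander invariant *)

Section Subquotient.
Variables (G : groupType) (H N : normal_subgroup G).

(** The class of an element of [H]; the elements outside [H] have the class of 1. *)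
Definition subq (x : G) : subquot H N := quot_proj _ (insubd (1 : subgT H) x).

Lemma val_insub x : H x -> val (insubd (1 : subgT H) x) = x.
Proof. by move=> Hx; apply: insubdK; exact/mem_set. Qed.

Lemma subq_eq x y : H x -> H y -> subq x = subq y <-> N (x^-1 * y).
Proof.
move=> Hx Hy; rewrite /subq.
have := @quot_projP _ (subg_restrict H N) (insubd 1 x) (insubd 1 y).
by move: (val_insub Hx) (val_insub Hy) => /= -> ->.
Qed.

Lemma subq_surj (a : subquot H N) : exists2 x, H x & subq x = a.
Proof.
elim/quot_ind: a => x; exists (val x); first exact/set_mem/(valP x).
by rewrite /subq valKd.
Qed.

Lemma subqM x y : H x -> H y -> subq (x * y) = subq x * subq y.
Proof.
move=> Hx Hy; rewrite /subq -quot_projM; congr (quot_proj _ _).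
by apply: val_inj; rewrite valM !val_insub //; exact: nsubM.
Qed.

Lemma subq1 : subq 1 = 1.
Proof.
by apply: (mulgI (subq 1)); rewrite -subqM ?mulg1 //; exact: nsub1.
Qed.

Lemma subqV x : H x -> subq x^-1 = (subq x)^-1.
Proof.
move=> Hx; apply/esym/mulg1_eq; rewrite -subqM ?mulgV ?subq1 //; exact: nsubV.
Qed.

Lemma subqX x m : H x -> subq (x ^+ m) = subq x ^+ m.
Proof.
move=> Hx; elim: m => [|m IHm]; first by rewrite !expg0 subq1.
by rewrite !expgS subqM ?IHm //; exact: nsubX.
Qed.

Lemma subq_eq1 x : H x -> subq x = 1 <-> N x.
Proof.
move=> Hx; rewrite -subq1 subq_eq //; last exact: nsub1.
by rewrite mulg1; split=> /nsubV; rewrite ?invgK.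
Qed.

(** Conjugation by [g^-1] in the sense of [_ ^ _], so as to act on the left. *)
Definition subq_act (g : G) (a : subquot H N) : subquot H N :=
  subq (val (repr a) ^ g^-1).

Lemma subq_actE g x : H x -> subq_act g (subq x) = subq (x ^ g^-1).
Proof.
move=> Hx; have Hy : H (val (repr (subq x))) by exact/set_mem/(valP (repr (subq x))).
apply/subq_eq; [exact: nsubJ|exact: nsubJ|].
rewrite -conjVg -conjMg; apply: nsubJ; apply/subq_eq => //.
by rewrite [LHS]/subq valKd quot_reprK.
Qed.

Lemma subq_actM g a b : subq_act g (a * b) = subq_act g a * subq_act g b.
Proof.
have [[x Hx <-] [y Hy <-]] := (subq_surj a, subq_surj b).
rewrite -subqM // !subq_actE //; last exact: nsubM.
by rewrite conjMg subqM //; exact: nsubJ.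
Qed.

Lemma subq_act1 a : subq_act 1 a = a.
Proof. by have [x Hx <-] := subq_surj a; rewrite subq_actE // invg1 conjg1. Qed.

Lemma subq_act_mul g h a : subq_act (g * h) a = subq_act g (subq_act h a).
Proof.
have [x Hx <-] := subq_surj a; rewrite !subq_actE //; last exact: nsubJ.
by rewrite invgM conjgM.
Qed.

End Subquotient.

Section AlexanderInvariant.
Variable G : groupType.
Let N := derivedQ G.
Let N2 := derivedQ2 G.
Let D := derived_subgroup (whole_group G).
Notation cl := (subq N N2).
Notation act := (@subq_act G N N2).

Lemma derived_sub_derivedQ x : D x -> N x.
Proof. by move=> Dx; exists 1%N. Qed.

Lemma comm_derivedQ x y : N [~ x, y].
Proof. by apply: derived_sub_derivedQ; exact: commutator_commg. Qed.

Lemma comm_derivedQ2 x y : N x -> N y -> N2 [~ x, y].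
Proof. by move=> Nx Ny; exists 1%N => //; exact: commutator_commg. Qed.

Lemma alexanderQ_abelian : abelian_group (alexanderQ G).
Proof.
move=> a b; have [[x Nx <-] [y Ny <-]] := (subq_surj a, subq_surj b).
rewrite -!subqM //; apply/subq_eq; [exact: nsubM|exact: nsubM|].
have -> : (x * y)^-1 * (y * x) = [~ y, x] by rewrite invgM commgEl conjgE !mulgA.
exact: comm_derivedQ2.
Qed.

Lemma subq_act_derivedQ n a : N n -> act n a = a.
Proof.
move=> Nn; have [x Nx <-] := subq_surj a; rewrite subq_actE //.
apply/esym/subq_eq => //; first exact: nsubJ.
by rewrite -commgEl; apply: comm_derivedQ2 => //; exact: nsubV.
Qed.

(** The commutator of [g] and [h] lies in [derivedQ G], which acts trivially. *)
Lemma subq_act_comm g h a : act g (act h a) = act h (act g a).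
Proof.
rewrite -!subq_act_mul.
have -> : g * h = [~ g^-1, h^-1] * (h * g) by exact: commgCV.
rewrite [LHS]subq_act_mul subq_act_derivedQ //; exact: comm_derivedQ.
Qed.

Lemma abf_projM x y : abf_proj (x * y) = abf_proj x * abf_proj y :> abf G.
Proof. by rewrite /abf_proj !quot_projM. Qed.

Lemma abf_proj_surj (a : abf G) : exists x, abf_proj x = a.
Proof. by elim/quot_ind: a; elim/quot_ind=> x; exists x. Qed.

Lemma abf_proj_eq x y : abf_proj x = abf_proj y :> abf G <-> N (x^-1 * y).
Proof.
rewrite /abf_proj; split.
  move=> /quot_projP [m m0]; rewrite -gmulfV -gmulfM -gmulfXn => /quot_proj_eq1 Dm.
  by exists m.
move=> [m m0 Dm]; apply/quot_projP; exists m => //.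
by rewrite -gmulfV -gmulfM -gmulfXn; apply/quot_proj_eq1.
Qed.

End AlexanderInvariant.

Local Open Scope ring_scope.

(** * Uncountability of the complex numbers *)

(** A countable set has measure zero, but the unit interval does not. *)
Lemma uncountable_real (R : realType) : ~ countable [set: R].
Proof.
move=> /(@sub_countable _ _ `[0%R, 1%R] _ (subset_card_le (@subsetT _ _))).
move=> /lebesgue_measure.countable_lebesgue_measure0 /eqP.
rewrite lebesgue_measure.lebesgue_measure_itv /=.
by rewrite lte_fin ltr01 -EFinB subr0 eqe oner_eq0.
Qed.

Lemma uncountable_complex (R : realType) : ~ countable [set: R[i]].
Proof.
move=> cC; apply: (@uncountable_real R); apply: sub_countable cC.
have <- : @complex.Re R @` [set: R[i]] = [set: R].
  by apply/seteqP; split=> // x _; exists (x%:C)%C.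
exact: card_image_le.
Qed.

Local Open Scope group_scope.

(** * The support of the rational Alexander invariant *)

Section Eigencharacters.
Variables (R : realType) (G : groupType).
Let C : numClosedFieldType := R[i].
Let N := derivedQ G.
Let N2 := derivedQ2 G.
Notation cl := (subq N N2).
Notation act := (@subq_act G N N2).
Variables (rho : G -> C) (phi : alexanderQ G -> C).
Hypothesis eig : eigenfunctional act rho phi.

Lemma eigen_morph : {morph rho : x y / (x * y)%g >-> (x * y)%R}.
Proof.
move=> x y; have [_ [a phia] phiact] := eig; apply: (mulIf phia).
by rewrite -phiact subq_act_mul !phiact mulrA.
Qed.

Lemma eigen_derivedQ x : N x -> rho x = 1%R.
Proof.
move=> Nx; have [_ [a phia] phiact] := eig; apply: (mulIf phia).
by rewrite -phiact subq_act_derivedQ // mul1r.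
Qed.

Lemma eigen_neq0 x : (rho x != 0)%R.
Proof.
have : (rho (x * x^-1) != 0)%R.
  by rewrite eigen_derivedQ ?oner_neq0 // mulgV; exact: nsub1.
by rewrite eigen_morph mulf_eq0 negb_or => /andP[].
Qed.

Lemma eigen_torus : character_torus R G rho.
Proof.
pose chi (a : abf G) : C := rho (repr (repr a)).
have chiE x : chi (abf_proj x) = rho x.
  have /abf_proj_eq Nyx : abf_proj (repr (repr (abf_proj x))) = abf_proj x :> abf G.
    by rewrite /abf_proj !quot_reprK.
  by rewrite /chi -[RHS](congr1 rho (mulVKg (repr (repr (abf_proj x))) x))
    eigen_morph (eigen_derivedQ Nyx) mulr1.
exists chi; last by apply/funext => x; rewrite /= chiE.
split=> [a|a b]; first exact: eigen_neq0.
have [[x <-] [y <-]] := (abf_proj_surj a, abf_proj_surj b).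
by rewrite -abf_projM !chiE eigen_morph.
Qed.

(** For [rho h != 1] the functional extends, up to the factor [rho h - 1], to a
    crossed homomorphism of the whole group. *)
Definition eigen_cocycle (h g : G) : C := phi (cl [~ h^-1, g^-1]).

Lemma eigen_cocycleM h x y :
  (eigen_cocycle h (x * y) = eigen_cocycle h x + rho x * eigen_cocycle h y)%R.
Proof.
have [phiD _ phiact] := eig.
rewrite /eigen_cocycle -phiact subq_actE; last exact: comm_derivedQ.
rewrite -phiD -subqM; [|exact: comm_derivedQ|apply: nsubJ; exact: comm_derivedQ].
congr (phi (cl _)); rewrite !commgEl !conjgE !invgK !invgM.
by rewrite !mulgA !mulgVK.
Qed.

Lemma eigen_cocycle_derivedQ h x : N x ->
  (eigen_cocycle h x = (rho h - 1) * phi (cl x))%R.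
Proof.
move=> Nx; have [phiD _ phiact] := eig; rewrite /eigen_cocycle.
have -> : [~ h^-1, x^-1] = x ^ h^-1 * x^-1.
  by rewrite commgEr invgK.
rewrite subqM; [|exact: nsubJ|exact: nsubV].
by rewrite phiD subqV // (additive_funV phiD) -subq_actE // phiact mulrBl mul1r.
Qed.

(** The crossed homomorphism is a functional on chains vanishing on boundaries,
    and it does not vanish on the cycle [<< x >>] when [x] is a point of
    [derivedQ G] seen by [phi]. *)
Lemma eigen_homology : (exists h, rho h != 1%R) -> W1 R G rho.
Proof.
move=> [h rhoh]; split; first exact: eigen_torus.
have [phiD [a phia] _] := eig; have [x Nx xa] := subq_surj a.
have ker_x : subm_pred (lin_ker (bar_d1 rho)) << x >>%R.
  by apply/mem_set; rewrite /= /mkset /bar_d1 liftU scale1r eigen_derivedQ // subrr.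
pose z : submT (lin_ker (bar_d1 rho)) := Sub _ ker_x.
apply: (@dimension_ge1 _ _ (quotV_proj _ z)); apply/eqP.
rewrite -[0%R](linear0 (quotV_proj _)) => /quotV_projP /=; rewrite /mkset /= subr0.
pose psi : G -> C^o := eigen_cocycle h.
have psi_d2 c : fglift psi (bar_d2 rho c) = 0%R.
  rewrite -[c]freeg_sumE !linear_sum big1 // => -[g g'] _ /=.
  rewrite -[coeff _ c]mulr1 -freegZU !linearZ.
  have d2U : bar_d2 rho << (g, g') >> =
      (rho g *: << g' >> - << (g * g')%g >> + << g >>)%R.
    by rewrite /bar_d2 liftU scale1r.
  rewrite /= d2U linearD linearB linearZ /= !liftU !scale1r.
  by rewrite /psi eigen_cocycleM opprD addrCA subrr addr0 addNr scaler0.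
move=> [c _ d2c]; have := psi_d2 c; rewrite d2c liftU scale1r /psi.
rewrite eigen_cocycle_derivedQ // xa => /eqP; rewrite mulf_eq0 subr_eq0.
by rewrite (negPf rhoh) (negPf phia).
Qed.

End Eigencharacters.

Section Generation.
Variables (G : groupType) (gs0 : seq G).
Hypothesis gs0_gen : generated_by [set` gs0] = setT.

Lemma generated_ind (S : set G) : is_subgroup S -> (forall g, g \in gs0 -> S g) ->
  forall x, S x.
Proof.
move=> subS Sgs x; apply: (generated_min subS Sgs).
by rewrite gs0_gen.
Qed.

Lemma generated_monoid_ind (S : set G) : S 1 ->
  (forall g x, g \in gs0 ++ [seq x^-1 | x <- gs0] -> S x -> S (g * x)) -> forall x, S x.
Proof.
move=> S1 SM x; rewrite -[x]mulg1.
suff /(_ x)/(_ 1)[] : forall x,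
    [set x | forall y, S y -> S (x * y) /\ S (x^-1 * y)] x by [].
apply: generated_ind => [|g ggs y Sy] /=.
  split=> [y Sy|u v uP vP y Sy|u uP y Sy] /=; first by rewrite invg1 !mul1g.
    rewrite invgM -!mulgA; split.
      by apply: (proj1 (uP _ _)); apply: (proj1 (vP _ _)).
    by apply: (proj2 (vP _ _)); apply: (proj2 (uP _ _)).
  by rewrite invgK; have [] := uP _ Sy.
by split; apply: SM => //; rewrite mem_cat ?ggs // (map_f _ ggs) orbT.
Qed.

(** Words in the generators and their inverses are coded by sequences of
    integers. *)
Lemma generated_enum : exists enumG : nat -> G, forall x, exists n, enumG n = x.
Proof.
pose gs := gs0 ++ [seq x^-1 | x <- gs0].
exists (fun n => \prod_(k <- odflt [::] (unpickle n : option (seq nat))) nth 1 gs k).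
apply: generated_monoid_ind => [|g x ggs [n <-]].
  by exists (pickle ([::] : seq nat)); rewrite pickleK /= big_nil.
exists (pickle (index g gs :: odflt [::] (unpickle n : option (seq nat)))).
by rewrite pickleK /= big_cons nth_index.
Qed.

(** Centralizers modulo [M] are subgroups. *)
Lemma commutator_sub_generators (M : normal_subgroup G) :
  (forall g h, g \in gs0 -> h \in gs0 -> M [~ g, h]) -> forall x y, M [~ x, y].
Proof.
have commE x y : M [~ x, y] <-> commute (quot_proj M x) (quot_proj M y).
  by rewrite -quot_proj_eq1 gmulfR; split=> [/eqP/commgP|/commgP/eqP].
have cent_sub x : is_subgroup [set y | M [~ x, y]].
  split=> [|y z|y] /=; rewrite !commE.
  - by rewrite gmulf1; exact: commute1.
  - by rewrite gmulfM; exact: commuteM.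
  - by rewrite gmulfV; exact: commuteV.
have sym x y : M [~ x, y] -> M [~ y, x] by rewrite !commE; exact: commute_sym.
move=> Mgs x; apply: (generated_ind (cent_sub x)) => h hgs.
apply: sym; move: x; apply: (generated_ind (cent_sub h)) => g ggs; exact: Mgs.
Qed.

(** The elements whose class lies in [S] form a normal subgroup; it contains the
    commutators of generators, hence all commutators, and [derivedQ G] consists of
    roots of products of commutators. *)
Lemma alexanderQ_generated (S : set (alexanderQ G)) : is_subgroup S ->
  (forall a m, (0 < m)%N -> S (a ^+ m) -> S a) ->
  (forall g a, S a -> S (subq_act g a)) ->
  (forall b, b \in [seq subq (derivedQ G) (derivedQ2 G) [~ x, y] |
      x <- gs0, y <- gs0] -> S b) ->
  forall a, S a.
Proof.
move=> [S1 SM SV] rootS actS Sgs a.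
pose N := derivedQ G; pose cl := subq N (derivedQ2 G).
have subM : is_subgroup [set x | N x /\ S (cl x)].
  split=> [|x y [Nx Sx] [Ny Sy]|x [Nx Sx]] /=.
  - by split; [exact: (nsub1 N)|rewrite /cl subq1].
  - by split; [exact: (nsubM (N := N))|rewrite /cl subqM //; exact: SM].
  - by split; [exact: (nsubV (N := N))|rewrite /cl subqV //; exact: SV].
have MJ x y : N x /\ S (cl x) -> N (x ^ y) /\ S (cl (x ^ y)).
  move=> [Nx Sx]; split; first exact: nsubJ.
  by rewrite -[y]invgK /cl -subq_actE //; exact: actS.
pose M := NormalSubgroup subM MJ.
have M_comm : forall x y, M [~ x, y].
  apply: commutator_sub_generators => g h ggs hgs; split; first exact: comm_derivedQ.
  by apply: Sgs; apply/allpairsP; exists (g, h).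
have [x [m m0 Dx] <-] := subq_surj a.
have Nx : N x by exists m.
apply: (rootS _ m m0); rewrite -subqX //.
suff [] : M (x ^+ m) by [].
move: (x ^+ m) Dx; apply: generated_min => // _ [u [v [_ _ ->]]]; exact: M_comm.
Qed.

End Generation.

Lemma finitely_generated_seq (G : groupType) : finitely_generated G ->
  exists gs : seq G, generated_by [set` gs] = setT.
Proof. by move=> [A [/finite_seqP[s ->] sG]]; exists s. Qed.

Theorem alexanderQ_finite_rank (R : realType) (G : groupType) :
  finitely_generated G -> finite_set (W1 R G) -> finite_rank (alexanderQ G).
Proof.
move=> /finitely_generated_seq [gs0 gs0_gen] W1fin.
have [enumG enumGP] := generated_enum gs0_gen.
pose cl := subq (derivedQ G) (derivedQ2 G).
have valP g : exists s : seq R[i], [set rho g | rho in W1 R G] = [set` s].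
  by apply/finite_seqP; exact: finite_image.
have [L LP] := choice valP.
apply: (@finite_support_finite_rank R[i] _ G (@subq_act G (derivedQ G) (derivedQ2 G))
  (@uncountable_complex R) (@alexanderQ_abelian G) (@subq_actM _ _ _)
  (@subq_act1 _ _ _) (@subq_act_mul _ _ _) (@subq_act_comm G) (cl \o enumG) _ _
  (alexanderQ_generated gs0_gen) _ (generated_monoid_ind gs0_gen)
  (fun g => 1%R :: L g)).
  by move=> a; have [x _ <-] := subq_surj a; have [n <-] := enumGP x; exists n.
move=> rho phi eig g; rewrite inE; have [//|rhog] := eqVneq (rho g) 1%R.
have : [set` L g] (rho g).
  by rewrite -LP; exists rho => //; apply: (eigen_homology eig); exists g.
by [].
Qed.

(** * Lower central series of metabelian groups *)

Lemma lower_central_sub (G : groupType) n x :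
  lower_central G n.+1 x -> lower_central G n x.
Proof.
case: n => [//|n]; apply: generated_min; first exact: nsub_subgroup.
move=> _ [u [v [_ Lv ->]]]; rewrite commgEr; apply: nsubM => //.
by apply: nsubJ; exact: nsubV.
Qed.

Lemma lower_central_le (G : groupType) m n x : (m <= n)%N ->
  lower_central G n x -> lower_central G m x.
Proof. by move=> /subnK <-; elim: (n - m)%N => // k IHk /lower_central_sub. Qed.

Lemma lower_central_commg (G : groupType) n x y :
  lower_central G n x -> lower_central G n.+1 [~ x, y].
Proof.
case: n => [//|n] Lx; rewrite -invgR; apply: nsubV; exact: commutator_commg.
Qed.

Lemma lower_central_quot (G : groupType) (N : normal_subgroup G) n x :
  lower_central G n x -> lower_central (quotg N) n (quot_proj N x).
Proof.
elim: n x => [//|[//|n] IHn x].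
apply: (generated_min (S := [set x | lower_central (quotg N) n.+2 (quot_proj N x)])).
  split=> [|u v Lu Lv|u Lu]; rewrite /mkset.
  - by rewrite gmulf1; exact: nsub1.
  - by rewrite gmulfM; exact: nsubM.
  - by rewrite gmulfV; exact: nsubV.
move=> _ [u [v [_ Lv ->]]]; rewrite /mkset gmulfR; apply: commutator_commg => //.
exact: IHn.
Qed.

Lemma lower_central_quot_lift (G : groupType) (N : normal_subgroup G) n a :
  lower_central (quotg N) n a -> exists2 x, lower_central G n x & quot_proj N x = a.
Proof.
have lift1 b : exists x, quot_proj N x = b by elim/quot_ind: b => x; exists x.
elim: n a => [|[|n] IHn] a; try by have [x <-] := lift1 a; exists x.
apply: (generated_min (S :=
  [set a | exists2 x, lower_central G n.+2 x & quot_proj N x = a])).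
  split=> [|_ _ [u Lu <-] [v Lv <-]|_ [u Lu <-]].
  - by exists 1; [exact: nsub1|exact: gmulf1].
  - by exists (u * v); [exact: nsubM|exact: gmulfM].
  - by exists u^-1; [exact: nsubV|exact: gmulfV].
move=> _ [u [v [_ /IHn[y Ly <-] ->]]]; have [x <-] := lift1 u.
by exists [~ x, y]; [exact: commutator_commg|rewrite gmulfR].
Qed.

Lemma commgX_commute (G : groupType) (x y : G) e :
  commute [~ x, y] y -> [~ x, y ^+ e] = [~ x, y] ^+ e.
Proof.
move=> cy; rewrite commgEl; apply: (mulgI x); rewrite mulVKg.
elim: e => [|e IHe]; first by rewrite !expg0 conjg1 mulg1.
rewrite expgSr conjgM IHe conjMg conjXg.
have -> : [~ x, y] ^ y = [~ x, y] by apply/conjg_fixP/commgP.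
by rewrite expgS mulgA [[~ x, y] in RHS]commgEl mulVKg.
Qed.

Section Metabelian.
Variables (M : groupType) (n : nat).
Hypothesis metabelianM : forall x y, lower_central M 2 x -> lower_central M 2 y ->
  commute x y.

(** The normal subgroup of those elements of [M'] which become torsion in
    [M / gamma_n(M)]. *)
Definition derived_root : set M :=
  [set x | lower_central M 2 x /\ exists2 m, (0 < m)%N & lower_central M n (x ^+ m)].

Lemma derived_root_subgroup : is_subgroup derived_root.
Proof.
split=> [|x y [Dx [k k0 Lx]] [Dy [m m0 Ly]]|x [Dx [m m0 Lx]]].
- by split; [exact: nsub1|exists 1%N => //; exact: nsub1].
- split; first exact: nsubM.
  exists (k * m)%N; first by rewrite muln_gt0 k0.
  rewrite expgMn; last exact: metabelianM.
  apply: nsubM; first by rewrite expgnA; exact: nsubX.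
  by rewrite mulnC expgnA; exact: nsubX.
- by split; [exact: nsubV|exists m => //; rewrite expVgn; exact: nsubV].
Qed.

Lemma derived_rootJ x y : derived_root x -> derived_root (x ^ y).
Proof.
move=> [Dx [m m0 Lx]]; split; first exact: nsubJ.
by exists m => //; rewrite -conjXg; exact: nsubJ.
Qed.

Definition derived_rootN := NormalSubgroup derived_root_subgroup derived_rootJ.
Let R := derived_rootN.

Lemma derived_root_root x m : lower_central M 2 x -> (0 < m)%N -> R (x ^+ m) -> R x.
Proof.
move=> Dx m0 [_ [k k0 Lx]]; split=> //; exists (m * k)%N; first by rewrite muln_gt0 m0.
by rewrite expgnA.
Qed.

(** If [x, y] commutes with [y] modulo [R], then [x, y^e] is its power of
    exponent [e] there, and [R] is closed under roots in [M']. *)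
Lemma derived_root_commX x y e : lower_central M 2 [~ x, y] -> (0 < e)%N ->
  R [~ [~ x, y], y] -> R [~ x, y ^+ e] -> R [~ x, y].
Proof.
move=> Dxy e0 Rc Re; apply: (derived_root_root Dxy e0).
apply/quot_proj_eq1; rewrite gmulfXn gmulfR -commgX_commute.
  by rewrite -gmulfXn -gmulfR; apply/quot_proj_eq1.
by apply/commgP; rewrite -!gmulfR; apply/eqP/quot_proj_eq1.
Qed.

(** Modulo [R], a root [t] of the derived subgroup acts on it by an automorphism
    that is unipotent and of finite order; it is trivial, since the quotient is
    torsion-free. *)
Lemma derived_root_comm_lower t e j b : (0 < e)%N -> lower_central M 2 (t ^+ e) ->
  lower_central M j.+2 b -> R [~ b, t].
Proof.
move=> e0 Dt; move: {2}(n - j.+2)%N (leqnn (n - j.+2)%N) => k.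
elim: k j b => [|k IHk] j b jk Lb; have Lc := lower_central_commg t Lb.
  split; first exact: lower_central_le Lc.
  exists 1%N => //; apply: lower_central_le Lc.
  by rewrite leqW // -subn_eq0 -leqn0.
apply: (@derived_root_commX _ _ e) => //; first exact: lower_central_le Lc.
  by apply: IHk Lc; lia.
have /commgP/eqP -> : commute b (t ^+ e).
  by apply: metabelianM => //; exact: lower_central_le Lb.
exact: nsub1.
Qed.

(** By the previous lemma [s] commutes with [t, s] modulo [R], and [s^d], which is in
    [M'], commutes with [t]. *)
Lemma derived_root_comm s t d e : (0 < d)%N -> (0 < e)%N ->
  lower_central M 2 (s ^+ d) -> lower_central M 2 (t ^+ e) -> R [~ s, t].
Proof.
move=> d0 e0 Ds Dt; have Dst : lower_central M 2 [~ t, s] by exact: commutator_commg.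
rewrite -invgR; apply: nsubV; apply: (derived_root_commX Dst d0).
  exact: (derived_root_comm_lower d0 Ds Dst).
by rewrite -invgR; apply: nsubV; exact: (derived_root_comm_lower e0 Dt Ds).
Qed.

End Metabelian.

Section ChenRanks.
Variable K : groupType.
Let N := derivedQ K.
Let N2 := derivedQ2 K.
Let M := max_metabelian K.
Notation cl := (subq N N2).

Lemma max_metabelianP (x y : M) : lower_central M 2 x -> lower_central M 2 y ->
  commute x y.
Proof.
move=> /lower_central_quot_lift [u Du <-] /lower_central_quot_lift [v Dv <-].
apply/commgP; rewrite -gmulfR; apply/eqP/quot_proj_eq1; exact: commutator_commg.
Qed.

Lemma lower_central_derivedQ n x : lower_central K n.+2 x -> N x.
Proof.
by move=> Lx; apply: derived_sub_derivedQ; exact: (@lower_central_le _ 2 _ _ _ Lx).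
Qed.

(** The closure in the rational Alexander invariant of the image of a term of the
    lower central series. *)
Definition alexander_filtration n : set (alexanderQ K) :=
  [set a | exists2 m, (0 < m)%N & exists2 x, lower_central K n.+2 x & a ^+ m = cl x].

Lemma alexander_filtration_subgroup n : is_subgroup (alexander_filtration n).
Proof.
split=> [|a b [m m0 [x Lx ax]] [k k0 [y Ly ay]]|a [m m0 [x Lx ax]]].
- by exists 1%N => //; exists 1; rewrite ?subq1 //; exact: nsub1.
- exists (m * k)%N; first by rewrite muln_gt0 m0.
  have [Nx Ny] := (lower_central_derivedQ Lx, lower_central_derivedQ Ly).
  exists (x ^+ k * y ^+ m); first by apply: nsubM; exact: nsubX.
  rewrite subqM; [|exact: nsubX|exact: nsubX].
  rewrite !subqX // -ax -ay expgMn; last exact: alexanderQ_abelian.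
  by rewrite -!expgnA [(k * m)%N]mulnC.
- exists m => //; exists x^-1; first exact: nsubV.
  by rewrite expVgn ax subqV //; exact: lower_central_derivedQ Lx.
Qed.

Lemma comm_derivedQ_derived_root n z :
  commutator_subgroup N N z -> derived_root n (quot_proj _ z : M).
Proof.
pose R := derived_rootN n max_metabelianP.
apply: (generated_min (S := [set z | R (quot_proj _ z : M)])).
  split=> [|u v Ru Rv|u Ru]; rewrite /mkset.
  - by rewrite gmulf1; exact: nsub1.
  - by rewrite gmulfM; exact: nsubM.
  - by rewrite gmulfV; exact: nsubV.
move=> _ [u [v [[d d0 Du] [e e0 Dv] ->]]]; rewrite /mkset gmulfR.
by apply: (derived_root_comm _ _ d0 e0); rewrite -gmulfXn; exact: lower_central_quot.
Qed.

(** For [n] large the filtration is stationary: if [x] is in [gamma_n], then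
    [x^m = z w] with [z] in [gamma_(n+1)] and [w] in [K''_Q]. In [M] both factors
    have a power in [gamma_(n+1)]. *)
Lemma chen_rank_vanish : finite_rank (alexanderQ K) ->
  exists n0, forall n, (n0 <= n)%N -> chen_rank K n = 0%E.
Proof.
move=> frK.
have [||n0 n0P] := isolated_chain_stationary (D := alexander_filtration)
    (@alexanderQ_abelian K) frK alexander_filtration_subgroup.
- move=> n a k k0 [m m0 [x Lx ax]]; exists (k * m)%N; first by rewrite muln_gt0 k0.
  by exists x => //; rewrite expgnA.
- move=> n a [m m0 [x Lx ax]]; exists m => //; exists x => //.
  exact: lower_central_sub.
exists n0.+2 => -[|[|n]] // n0n; apply: torsion_dimension => a.
have [y Ly <-] := subq_surj a.
suff [m m0 Lm] : exists2 m, (0 < m)%N & lower_central M n.+3 (y ^+ m).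
  by exists m => //; rewrite -subqX //; apply/subq_eq1 => //; exact: nsubX.
have [x Lx xy] := lower_central_quot_lift Ly.
have Nx := lower_central_derivedQ Lx.
have [|m m0 [z Lz xz]] := n0P n n0n (cl x); first by exists 1%N => //; exists x.
have Nz := lower_central_derivedQ Lz.
move: xz; rewrite -subqX // => /esym/subq_eq [//||e e0 Ne]; first exact: nsubX.
pose R := derived_rootN n.+3 max_metabelianP.
pose w : K := z^-1 * x ^+ m.
have Dw : lower_central M 2 (quot_proj _ w : M).
  apply: lower_central_quot; apply: nsubM.
    by apply: nsubV; exact: lower_central_le Lz.
  by apply: nsubX; exact: lower_central_le Lx.
have Rw : R (quot_proj _ w : M).
  apply: (@derived_root_root M n.+3 max_metabelianP _ _ Dw e0); rewrite -gmulfXn.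
  exact: comm_derivedQ_derived_root.
have Rz : R (quot_proj _ z : M).
  split; first by apply: lower_central_quot; exact: lower_central_le Lz.
  by exists 1%N => //; exact: lower_central_quot.
have [_ [k k0 Lk]] : R (y ^+ m).
  have -> : y ^+ m = quot_proj _ z * quot_proj _ w :> M.
    by rewrite -xy -gmulfXn -gmulfM mulVKg.
  exact: nsubM.
by exists (m * k)%N; [rewrite muln_gt0 m0|rewrite expgnA].
Qed.

End ChenRanks.

(** * abf-exact sequences with torsion-free abelian quotient *)

Section Transfer.
Variables (K G Q : groupType).
Variables (i : {multiplicative K -> G}) (p : {multiplicative G -> Q}).
Hypotheses (ex : short_exact i p) (abfex : abf_exact i p).
Hypotheses (abQ : abelian_group Q) (tfQ : torsion_free Q).

Let i1 : i 1 = 1. Proof. by apply: (mulgI (i 1)); rewrite -gmulfM !mulg1. Qed.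
Let iV x : i x^-1 = (i x)^-1. Proof. by apply/esym/mulg1_eq; rewrite -gmulfM mulgV. Qed.
Let p1 : p 1 = 1. Proof. by apply: (mulgI (p 1)); rewrite -gmulfM !mulg1. Qed.
Let pV x : p x^-1 = (p x)^-1. Proof. by apply/esym/mulg1_eq; rewrite -gmulfM mulgV. Qed.
Let iX x m : i (x ^+ m) = i x ^+ m.
Proof. by elim: m => [|m IHm]; rewrite ?expg0 // !expgS gmulfM IHm. Qed.
Let pX x m : p (x ^+ m) = p x ^+ m.
Proof. by elim: m => [|m IHm]; rewrite ?expg0 // !expgS gmulfM IHm. Qed.

(** Membership in [derivedQ] is triviality in the torsion-free abelianization, on
    which [i] induces an injection. *)
Lemma abf_exact_derivedQ x : derivedQ G (i x) <-> derivedQ K x.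
Proof.
have [abf_inj _ _] := abfex.
have eq1 (H : groupType) (y : H) : derivedQ H y <-> abf_proj 1 = abf_proj y :> abf H.
  by rewrite abf_proj_eq invg1 mul1g.
rewrite !eq1 -{1}i1 -!abf_mapE; split=> [/abf_inj|->] //.
Qed.

(** [Q] is torsion-free abelian, so [p] kills [derivedQ G]. *)
Lemma derivedQ_in_range g : derivedQ G g -> exists2 x, derivedQ K x & i x = g.
Proof.
move=> Ng; have [m m0 Dg] := Ng; have [_ range_i _] := ex.
have [x _ xg] : range i g.
  rewrite range_i /=; apply: (tfQ m0); rewrite -pX; move: (g ^+ m) Dg.
  apply: (generated_min (S := [set g | p g = 1])).
    split=> [|u v|u] /=; first exact: p1.
      by rewrite gmulfM => -> ->; rewrite mulg1.
    by rewrite pV => ->; rewrite invg1.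
  move=> _ [u [v [_ _ ->]]] /=; rewrite commgEl conjgE !(gmulfM, pV).
  by rewrite (abQ (p u) (p v)) mulKg mulVg.
by exists x => //; rewrite -xg in Ng; exact/abf_exact_derivedQ.
Qed.

Lemma abf_exact_derivedQ2 x : derivedQ2 G (i x) -> derivedQ2 K x.
Proof.
have [i_inj _ _] := ex.
move=> [m m0]; rewrite -iX => Dx; exists m => //.
suff [y Dy /i_inj <-] : exists2 y, commutator_subgroup (derivedQ K) (derivedQ K) y &
  i y = i (x ^+ m) by [].
move: (i (x ^+ m)) Dx; apply: (generated_min (S := [set g | exists2 y,
    commutator_subgroup (derivedQ K) (derivedQ K) y & i y = g])).
  split=> [|_ _ [u Du <-] [v Dv <-]|_ [u Du <-]].
  - by exists 1; [exact: nsub1|].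
  - by exists (u * v); [exact: nsubM|exact: gmulfM].
  - by exists u^-1; [exact: nsubV|exact: iV].
move=> _ [_ [_ [/derivedQ_in_range[u Nu <-] /derivedQ_in_range[v Nv <-] ->]]].
exists [~ u, v]; first exact: commutator_commg.
by rewrite !commgEl !conjgE !(gmulfM, iV).
Qed.

(** [i] identifies the two rational Alexander invariants. *)
Lemma abf_exact_finite_rank : finite_rank (alexanderQ G) -> finite_rank (alexanderQ K).
Proof.
pose clG := subq (derivedQ G) (derivedQ2 G).
pose clK := subq (derivedQ K) (derivedQ2 K).
have lift a : exists k, derivedQ K k /\ clG (i k) = a.
  by have [g /derivedQ_in_range[k Nk <-] <-] := subq_surj a; exists k.
have [f fP] := choice lift.
move=> [bs bsP]; exists [seq clK (f b) | b <- bs] => a.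
have [x Nx <-] := subq_surj a; have Nix := proj2 (abf_exact_derivedQ x) Nx.
have [m m0 xm] := bsP (clG (i x)); exists m => //.
have [b1 bM bV] := generated_subgroup [set` [seq clK (f b) | b <- bs]].
have [k [Nk ik bk]] : exists k, [/\ derivedQ K k, clG (i k) = clG (i x) ^+ m &
    generated_by [set` [seq clK (f b) | b <- bs]] (clK k)].
  move: (clG (i x) ^+ m) xm; apply: (generated_min (S := [set a | exists k,
    [/\ derivedQ K k, clG (i k) = a &
    generated_by [set` [seq clK (f b) | b <- bs]] (clK k)]])).
    split=> [|_ _ [u [Nu <- bu]] [v [Nv <- bv]]|_ [u [Nu <- bu]]].
    - by exists 1; split; [exact: nsub1|rewrite i1 /clG subq1|rewrite /clK subq1].
    - exists (u * v); split; first exact: nsubM.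
        by rewrite gmulfM /clG subqM //; exact/abf_exact_derivedQ.
      by rewrite /clK subqM //; exact: bM.
    - exists u^-1; split; first exact: nsubV.
        by rewrite iV /clG subqV //; exact/abf_exact_derivedQ.
      by rewrite /clK subqV //; exact: bV.
  move=> b bbs; have [Nb fb] := fP b; exists (f b); split=> //.
  by apply: sub_generated; exact: map_f.
suff <- : clK k = clK x ^+ m by [].
rewrite /clK -subqX //; apply/subq_eq => //; first exact: nsubX.
apply: abf_exact_derivedQ2; rewrite gmulfM iV iX; apply/subq_eq.
- exact/abf_exact_derivedQ.
- exact: nsubX.
- by rewrite subqX.
Qed.

End Transfer.

Theorem corollary13p6 (R : realType) (K G Q : groupType)
    (i : {multiplicative K -> G}) (p : {multiplicative G -> Q}) :
  finitely_generated K -> finitely_generated G -> finitely_generated Q ->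
  short_exact i p -> abf_exact i p ->
  abelian_group Q -> torsion_free Q ->
  finite_set (W1 R G) ->
  (dimension (tensQ (alexanderQ K)) < +oo)%E /\
  (exists N : nat, forall n : nat, (N <= n)%N -> chen_rank K n = 0%E).
Proof.
move=> _ fgG _ ex abfex abQ tfQ W1fin.
have frK : finite_rank (alexanderQ K).
  apply: (abf_exact_finite_rank ex abfex abQ tfQ).
  exact: alexanderQ_finite_rank W1fin.
by split; [exact: finite_rank_dimension|exact: chen_rank_vanish].
Qed.
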